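(* We have $\mathrm{RSC}^{\mathbb{Z}}_k=\mathrm{RSC}^{\mathbb{Q}}_k$ as full subcategories of $\mathrm{PSh}(\mathrm{Cor}_k)$; that is, a presheaf with transfers over $k$ is a $\mathbb{Z}$-reciprocity presheaf if and only if it is a $\mathbb{Q}$-reciprocity presheaf.
   Context: **Correspondences.** $k$ is a fixed field; products are over $k$. $\mathrm{Sm}_k$ is the category of smooth separated $k$-schemes of finite type. $\mathrm{Cor}_k$ has the same objects; $\mathrm{Cor}_k(X,Y)$ is the group of algebraic cycles on $X\times Y$ whose components are finite over $X$ and surject onto a connected component of $X$, with the usual composition. For an additive category $\mathcal C$, $\mathrm{PSh}(\mathcal C)$ is the category of additive functors $\mathcal C^{op}\to\mathrm{Ab}$; $\mathbb{Z}_{\mathrm{tr}}$ is the Yoneda embedding. **$\Lambda$-modulus pairs** ($\Lambda\in\{\mathbb{Z},\mathbb{Q}\}$). A $\mathbb{Q}$-Cartier divisor on a noetherian scheme $X$ is an element of $\mathrm{CDiv}(X)\otimes\mathbb{Q}$; it is $\mathbb{Q}$-effective if it equals $rE$ with $E$ an effective Cartier divisor and $r\in\mathbb{Q}_{>0}$, with support $|E|$; $D\le D'$ means $D'-D$ is $\mathbb{Q}$-effective. For $\Lambda=\mathbb{Z}$ one uses ordinary (effective) Cartier divisors. A $\Lambda$-modulus pair is $\mathcal X=(X,D_X)$ with $X$ a separated $k$-scheme of finite type and $D_X$ a $\Lambda$-effective $\Lambda$-Cartier divisor such that $X^\circ:=X\setminus|D_X|$ is smooth over $k$; it is proper if $X$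 is proper over $k$. $\mathrm{MCor}^\Lambda_k$ is the category of proper $\Lambda$-modulus pairs, where morphisms $\mathcal X\to\mathcal Y$ are the elements of $\mathrm{Cor}_k(X^\circ,Y^\circ)$ each of whose components $V$ satisfies: the closure $\overline V\subset X\times Y$ is proper over $X$, and on the normalization $\overline V^N$ the pullback of $D_X$ is $\ge$ the pullback of $D_Y$. Put $\mathcal X\otimes\mathcal Y=(X\times Y,\mathrm{pr}_1^*D_X+\mathrm{pr}_2^*D_Y)$. **$h_0$.** Let $\overline\square=(\mathbb{P}^1,[\infty])$ with sections $i_0,i_1:(\mathrm{Spec}\,k,\emptyset)\to\overline\square$. For $F\in\mathrm{PSh}(\mathrm{MCor}^\Lambda_k)$ put $h_0^{\overline\square}F(\mathcal X)=\mathrm{Coker}(F(\mathcal X\otimes\overline\square)\xrightarrow{i_0^*-i_1^*}F(\mathcal X))$. $\omega_!:\mathrm{PSh}(\mathrm{MCor}^\Lambda_k)\to\mathrm{PSh}(\mathrm{Cor}_k)$ is the left Kan extension of $(X,D_X)\mapsto X^\circ$, explicitly $\omega_!F(X)=\varinjlim_{m>0}F(Y,mD_Y)$ for any proper pair with $Y^\circ\simeq X$. Put $h_0(\mathcal X)=\omega_!h_0^{\overline\square}\mathbb{Z}_{\mathrm{tr}}(\mathcal X)$; there is a canonical epimorphism $\mathbb{Z}_{\mathrm{tr}}(X^\circ)\twoheadrightarrow h_0(\mathcal X)$. **Reciprocity.** Let $F\in\mathrm{PSh}(\mathrm{Cor}_k)$, $X\in\mathrm{Sm}_k$, $a\in F(X)$.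 A proper $\Lambda$-modulus pair $\mathcal Y$ with $Y^\circ\simeq X$ is a $\Lambda$-modulus for $a$ if $a:\mathbb{Z}_{\mathrm{tr}}(X)\to F$ factors through $\mathbb{Z}_{\mathrm{tr}}(X)\twoheadrightarrow h_0(\mathcal Y)$. $F$ is a $\Lambda$-reciprocity presheaf if every section of $F$ over every $X\in\mathrm{Sm}_k$ admits a $\Lambda$-modulus; $\mathrm{RSC}^\Lambda_k\subset\mathrm{PSh}(\mathrm{Cor}_k)$ is the full subcategory of such $F$. *)

(* Defs.v *)
From HB Require Import structures.
From mathcomp Require Import all_boot all_order all_algebra.
From mathcomp Require Import generic_quotient ring_quotient.
From mathcomp Require Import all_classical topology.
From mathcomp Require Import -(notations) mpoly.
Set Implicit Arguments.
Unset Strict Implicit.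
Unset Printing Implicit Defensive.
Import GRing.Theory.
Local Open Scope classical_set_scope.
Local Open Scope ring_scope.
Local Open Scope quotient_scope.

(******************************************************************************)
(* Conventions.  Schemes are locally ringed spaces with an affine open cover.  *)
(* A structure sheaf is a family of rings indexed by all subsets of the space  *)
(* (so that the ring of an iterated preimage is convertible to the ring of the *)
(* preimage by the composite), but only its values on open sets are ever       *)
(* constrained or used; the values on other sets are arbitrary.                *)
(* Objects determined up to unique isomorphism (products, normalizations,      *)
(* local rings...) are described by their defining properties.                 *)
(******************************************************************************)

(** * Commutative algebra *)

Section Ring.
Variable A : comPzRingType.

Definition is_unit (u : A) := exists v, u * v = 1.

Definition ideal (I : set A) :=
  [/\ I 0, forall a b, I a -> I b -> I (a + b) & forall a b, I b -> I (a * b)].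

Definition prime_ideal (I : set A) :=
  [/\ ideal I, ~ I 1 & forall a b, I (a * b) -> I a \/ I b].

Definition ideal_span (G : set A) : set A :=
  [set a | forall I, ideal I -> G `<=` I -> I a].

Definition domain := (1 : A) != 0 /\ forall a b : A, a * b = 0 -> a = 0 \/ b = 0.

End Ring.

Arguments domain : clear implicits.

Section RingMaps.
Variables A B : comPzRingType.

Definition ring_morphism (f : A -> B) := zmod_morphism f /\ monoid_morphism f.

Definition is_localization (s : A) (f : A -> B) :=
  [/\ ring_morphism f, is_unit (f s),
      forall b, exists a n, b * f s ^+ n = f a
    & forall a, f a = 0 -> exists n, s ^+ n * a = 0].

Definition fg_algebra (f : A -> B) := exists n (g : 'I_n -> B),
  forall S : set B, (forall a, S (f a)) -> (forall i, S (g i)) ->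
    (forall x y, S x -> S y -> S (x + y) /\ S (x * y)) -> forall x, S x.

Definition fg_module (f : A -> B) := exists n (g : 'I_n -> B),
  forall x, exists c : 'I_n -> A, x = \sum_i f (c i) * g i.

Definition integral_over (f : A -> B) (b : B) := exists n (e : 'I_n -> A),
  b ^+ n = \sum_i f (e i) * b ^+ i.

(* B is, via f, the integral closure of the domain A in its fraction field;
   the last clause says that every fraction a / c integral over A lies in B *)
Definition is_integral_closure (f : A -> B) :=
  [/\ domain A /\ domain B, ring_morphism f, injective f,
      (forall b, integral_over f b /\ exists a c, c != 0 /\ f c * b = f a)
    & forall a c n (e : 'I_n -> A), c != 0 ->
        a ^+ n = \sum_i e i * (a ^+ i * c ^+ (n - i)) ->
        exists b, f c * b = f a].

End RingMaps.

Section Length.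
Variables (A : comPzRingType) (V : lmodType A).

Definition submodule (M : set V) :=
  [/\ M 0, forall x y, M x -> M y -> M (x + y) & forall a x, M x -> M (a *: x)].

(* the quotient module Z / B has a composition series of length n *)
Definition has_length (B Z : set V) (n : nat) := exists M : nat -> set V,
  [/\ M 0%N = B, M n = Z, forall i, (i <= n)%N -> submodule (M i)
    & forall i, (i < n)%N ->
      [/\ M i `<=` M i.+1, M i <> M i.+1
        & forall P, submodule P -> M i `<=` P -> P `<=` M i.+1 ->
            P = M i \/ P = M i.+1]].

End Length.

Section Tor.
Variables (A : comPzRingType) (I J : set A).

(* a resolution of A / I by free modules 'rV_(r i), with augmentation induced
   by e; the matrices act on row vectors by right multiplication *)
Definition is_free_resolution (r : nat -> nat) (e : 'M[A]_(r 0%N, 1))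
    (d : forall i, 'M[A]_(r i.+1, r i)) :=
  [/\ forall a, exists v : 'rV_(r 0%N), I ((v *m e) ord0 ord0 - a),
      forall v : 'rV_(r 0%N),
        I ((v *m e) ord0 ord0) <-> exists w, v = w *m d 0%N
    & forall i (v : 'rV_(r i.+1)), v *m d i = 0 <-> exists w, v = w *m d i.+1].

(* Tor_i (A / I, A / J) is tor_cycles i / tor_boundaries i *)
Definition tor_cycles (r : nat -> nat) (d : forall i, 'M[A]_(r i.+1, r i)) i :
    set 'rV[A]_(r i) :=
  match i with
  | 0%N => setT
  | i'.+1 => [set v | forall j, J ((v *m d i') ord0 j)]
  end.

Definition tor_boundaries (r : nat -> nat) (d : forall i, 'M[A]_(r i.+1, r i))
    i : set 'rV[A]_(r i) :=
  [set v | exists w : 'rV_(r i.+1), forall j, J ((v - w *m d i) ord0 j)].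

Arguments tor_cycles {r} d i : rename.
Arguments tor_boundaries {r} d i : rename.

(* n = \sum_i (-1)^i length (Tor_i (A / I, A / J)) *)
Definition is_tor_euler_char (n : int) := exists r e d,
  @is_free_resolution r e d /\ exists (l : nat -> nat) N,
  [/\ forall i, has_length (tor_boundaries d i) (tor_cycles d i) (l i),
      forall i, (N <= i)%N -> l i = 0%N
    & n = \sum_(i < N) (-1) ^+ i *+ l i].

End Tor.

(** * Schemes *)

Record presheafed := Presheafed {
  space :> topologicalType;
  osh : set space -> comPzRingType;
  osr : forall U V : set space, osh U -> osh V }.

Arguments osh : clear implicits.
Arguments osr {X} U V : rename.

Section LocalNotions.
Variable X : presheafed.
Implicit Types (U V : set X) (x : X).

Definition invertible_at x U (s : osh X U) := exists V,
  [/\ open V, V x, V `<=` U & is_unit (osr U V s)].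

Definition basic_open U (s : osh X U) : set X :=
  [set x | U x /\ invertible_at x s].

(* (U, O_X|U) is the spectrum of O_X(U): the points of U are the prime ideals
   of O_X(U), the D(s) form a basis of the topology, and O_X(D(s)) is O_X(U)_s *)
Definition affine_open U :=
  [/\ open U,
      forall P : set (osh X U), prime_ideal P -> exists! x,
        U x /\ forall s, P s <-> ~ basic_open s x,
      forall V x, open V -> V `<=` U -> V x -> exists s : osh X U,
        basic_open s x /\ basic_open s `<=` V
    & forall s : osh X U, is_localization s (osr U (basic_open s))].

Definition is_sheaf :=
  [/\ (forall U V, open U -> open V -> V `<=` U -> ring_morphism (@osr X U V)),
      (forall U (s : osh X U), open U -> osr U U s = s),
      (forall U V W (s : osh X U), open U -> open V -> open W ->
        V `<=` U -> W `<=` V -> osr V W (osr U V s) = osr U W s),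
      (forall U (C : set (set X)) (s : osh X U), open U ->
        (forall V, C V -> open V /\ V `<=` U) -> U `<=` \bigcup_(V in C) V ->
        (forall V, C V -> osr U V s = 0) -> s = 0)
    & (forall U (C : set (set X)) (s : forall V, osh X V), open U ->
        (forall V, C V -> open V /\ V `<=` U) -> U `<=` \bigcup_(V in C) V ->
        (forall V W, C V -> C W ->
          osr V (V `&` W) (s V) = osr W (V `&` W) (s W)) ->
        exists t : osh X U, forall V, C V -> osr U V t = s V)].

Definition has_local_stalks := forall x U, open U -> U x ->
  (1 : osh X U) != 0 /\
  forall a b : osh X U, a + b = 1 -> invertible_at x a \/ invertible_at x b.

Definition is_scheme :=
  [/\ is_sheaf, has_local_stalks & forall x, exists U, affine_open U /\ U x].

(* A is the local ring of X at x; germ is only meaningful on open U containing x *)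
Definition is_stalk x (A : comPzRingType) (germ : forall U, osh X U -> A) :=
  [/\ forall U, open U -> U x -> ring_morphism (@germ U),
      forall U V (s : osh X U), open U -> open V -> V x -> V `<=` U ->
        germ V (osr U V s) = germ U s,
      forall a, exists U (s : osh X U), [/\ open U, U x & a = germ U s]
    & forall U (s : osh X U), open U -> U x -> germ U s = 0 ->
        exists V, [/\ open V, V x, V `<=` U & osr U V s = 0]].

(* s is a nonzerodivisor of every local ring of U *)
Definition regular_section U (s : osh X U) := forall V (a : osh X V),
  open V -> V `<=` U -> osr U V s * a = 0 -> a = 0.

(* for sober X: x is the generic point of an irreducible component of S *)
Definition generic_point (S : set X) x :=
  S x /\ forall y, S y -> closure [set y] x -> y = x.

Definition integral_scheme := [set: X] !=set0 /\
  forall U, open U -> U !=set0 -> domain (osh X U).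

End LocalNotions.

Record kscheme (k : fieldType) := KScheme {
  kpre :> presheafed;
  kstr : k -> osh kpre setT;
  kpre_scheme : is_scheme kpre;
  kstr_morph : ring_morphism kstr }.

Section Morphisms.
Variable k : fieldType.
Implicit Types X Y Z T P : kscheme k.

Record mor X Y := Mor {
  mfun :> X -> Y;
  msh : forall U : set Y, osh Y U -> osh X (mfun @^-1` U);
  mfun_cont : forall U, open U -> open (mfun @^-1` U);
  msh_morph : forall U, open U -> ring_morphism (@msh U);
  msh_res : forall U V (s : osh Y U), open U -> open V -> V `<=` U ->
    msh (osr U V s) = osr (mfun @^-1` U) (mfun @^-1` V) (msh s);
  msh_local : forall U (s : osh Y U) x, open U -> U (mfun x) ->
    invertible_at x (msh s) -> invertible_at (mfun x) s;
  msh_k : forall c, msh (kstr Y c) = kstr X c }.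

Arguments msh {X Y} m U.

Definition mor_eq X Y (f g : mor X Y) := (forall x, f x = g x) /\
  forall U V (s : osh Y U), open U -> open V ->
    V `<=` f @^-1` U -> V `<=` g @^-1` U ->
    osr (f @^-1` U) V (msh f U s) = osr (g @^-1` U) V (msh g U s).

Lemma ring_morphism_comp (A B C : comPzRingType) (g : B -> C) (f : A -> B) :
  ring_morphism g -> ring_morphism f -> ring_morphism (g \o f).
Proof.
move=> [gB [g1 gM]] [fB [f1 fM]]; split; first by move=> a b; rewrite /= fB gB.
by split; [rewrite /= f1 g1 | move=> a b; rewrite /= fM gM].
Qed.

Program Definition mor_comp X Y Z (g : mor Y Z) (f : mor X Y) : mor X Z :=
  @Mor X Z (g \o f) (fun U s => msh f (g @^-1` U) (msh g U s)) _ _ _ _ _.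
Next Obligation.
by move=> X Y Z g f U oU; exact: (mfun_cont f (mfun_cont g oU)).
Qed.
Next Obligation.
move=> X Y Z g f U oU; apply: ring_morphism_comp (msh_morph g oU).
exact: msh_morph (mfun_cont g oU).
Qed.
Next Obligation.
move=> X Y Z g f U V s oU oV VU /=; rewrite msh_res // msh_res //.
- exact: mfun_cont.
- exact: mfun_cont.
- by move=> y; exact: VU.
Qed.
Next Obligation.
move=> X Y Z g f U s x oU Ux h; apply: (msh_local oU Ux).
exact: (@msh_local _ _ f (g @^-1` U) (msh g U s) x (mfun_cont g oU) Ux h).
Qed.
Next Obligation. by move=> X Y Z g f c /=; rewrite !(msh_k g, msh_k f). Qed.

Program Definition mor_id X : mor X X := @Mor X X id (fun U s => s) _ _ _ _ _.
Next Obligation. by []. Qed.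
Next Obligation. by move=> X U oU; do !split. Qed.
Next Obligation. by []. Qed.
Next Obligation. by []. Qed.
Next Obligation. by []. Qed.

Definition is_pullback X Y Z (f : mor X Z) (g : mor Y Z)
    P (p : mor P X) (q : mor P Y) :=
  mor_eq (mor_comp f p) (mor_comp g q) /\
  forall T (a : mor T X) (b : mor T Y),
    mor_eq (mor_comp f a) (mor_comp g b) ->
    exists h : mor T P, [/\ mor_eq (mor_comp p h) a, mor_eq (mor_comp q h) b
      & forall h', mor_eq (mor_comp p h') a -> mor_eq (mor_comp q h') b ->
          mor_eq h' h].

Definition is_product X Y P (p : mor P X) (q : mor P Y) :=
  forall T (a : mor T X) (b : mor T Y),
    exists h : mor T P, [/\ mor_eq (mor_comp p h) a, mor_eq (mor_comp q h) b
      & forall h', mor_eq (mor_comp p h') a -> mor_eq (mor_comp q h') b ->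
          mor_eq h' h].

Definition open_immersion X Y (f : mor X Y) :=
  [/\ injective f, forall U : set X, open U -> open (f @` U)
    & forall V : set Y, open V -> V `<=` range f -> bijective (msh f V)].

Definition closed_immersion X Y (f : mor X Y) :=
  [/\ injective f, forall Z : set X, closed Z -> closed (f @` Z)
    & forall V (s : osh X (f @^-1` V)) x, open V -> V (f x) ->
        exists W (t : osh Y W), [/\ open W, W (f x), W `<=` V
          & osr (f @^-1` V) (f @^-1` W) s = msh f W t]].

Definition separated X Y (f : mor X Y) := exists P (p q : mor P X) (d : mor X P),
  [/\ is_pullback f f p q, mor_eq (mor_comp p d) (mor_id X),
      mor_eq (mor_comp q d) (mor_id X) & closed_immersion d].

Definition finite_type X Y (f : mor X Y) := forall y, exists V,
  [/\ affine_open V, V y & exists n (U : 'I_n -> set X),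
    f @^-1` V = \bigcup_i U i /\
    forall i, affine_open (U i) /\
      fg_algebra (fun s : osh Y V => osr (f @^-1` V) (U i) (msh f V s))].

Definition universally_closed X Y (f : mor X Y) :=
  forall T (g : mor T Y) P (p : mor P X) (q : mor P T),
    is_pullback f g p q -> forall Z : set P, closed Z -> closed (q @` Z).

Definition proper X Y (f : mor X Y) :=
  [/\ separated f, finite_type f & universally_closed f].

Definition finite_mor X Y (f : mor X Y) := forall y, exists V,
  [/\ affine_open V, V y, affine_open (f @^-1` V) & fg_module (msh f V)].

(* N is the normalization of the integral scheme V *)
Definition is_normalization X Y (nu : mor X Y) := forall U : set Y,
  affine_open U -> U !=set0 ->
  affine_open (nu @^-1` U) /\ is_integral_closure (msh nu U).

Definition is_spec_k X := (exists x : X, forall y, y = x) /\ bijective (kstr X).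

Definition over_k (Q : forall X Y, mor X Y -> Prop) X :=
  exists S (f : mor X S), is_spec_k S /\ Q X S f.

(* U is the spectrum of a standard smooth k-algebra
   k[x_1, ..., x_(c+d)] / (f_1, ..., f_c), where phi is the presentation *)
Definition standard_smooth X (U : set X) := affine_open U /\
  exists c d (phi : {rmorphism mpoly.mpoly (c + d) k -> osh X U})
    (f : 'I_c -> mpoly.mpoly (c + d) k),
  [/\ forall a, phi (mpoly.mpolyC (c + d) a) = osr setT U (kstr X a),
      forall s, exists p, phi p = s,
      forall p, phi p = 0 <->
        exists g : 'I_c -> mpoly.mpoly (c + d) k, p = \sum_i g i * f i
    & is_unit (phi (\det
        (\matrix_(i < c, j < c) mpoly.mderiv (lshift d j) (f i))))].

Definition smooth_over_k X := forall x : X, exists U,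
  standard_smooth U /\ U x.

End Morphisms.

Arguments msh {k X Y} m U.
Arguments over_k {k} Q X.

(** * A fixed choice of products *)

(* The empty scheme only serves as a default value for prodS, needed because
   the existence of products of schemes is not proved here. *)
Section EmptyScheme.

Definition zero_ring := unit.
HB.instance Definition _ := Choice.on zero_ring.
Let z2 (x y : zero_ring) : zero_ring := tt.
Let zA : associative z2. Proof. by []. Qed.
Let zC : commutative z2. Proof. by []. Qed.
Let z0 : left_id (tt : zero_ring) z2. Proof. by case. Qed.
Let zN : left_inverse (tt : zero_ring) (fun=> tt : zero_ring) z2.
Proof. by []. Qed.
Let zDl : left_distributive z2 z2. Proof. by []. Qed.
HB.instance Definition _ := GRing.isZmodule.Build zero_ring zA zC z0 zN.
HB.instance Definition _ :=
  GRing.Zmodule_isComPzRing.Build zero_ring zA zC z0 zDl.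

Definition empty_space := void.
HB.instance Definition _ := Choice.on empty_space.
HB.instance Definition _ := isOpenTopological.Build empty_space
  (I : [set: set empty_space] setT) (fun _ _ _ _ => I) (fun _ _ _ => I).

Definition empty_pre :=
  @Presheafed empty_space (fun=> zero_ring : comPzRingType) (fun _ _ _ => tt).

Lemma zero_ringP (x y : zero_ring) : x = y. Proof. by case: x; case: y. Qed.

Lemma zero_ring_morph (A : comPzRingType) (f : A -> zero_ring) : ring_morphism f.
Proof.
by split; [move=> x y | split; [|move=> x y]]; exact: zero_ringP.
Qed.

Lemma empty_is_scheme : is_scheme empty_pre.
Proof.
split; [split | by case | by case].
- by move=> U V _ _ _; exact: zero_ring_morph.
- by move=> U s _; exact: zero_ringP.
- by move=> U V W s _ _ _ _ _; exact: zero_ringP.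
- by move=> U C s _ _ _ _; exact: zero_ringP.
- by move=> U C s _ _ _ _; exists (0 : zero_ring) => V _; exact: zero_ringP.
Qed.

Variable k : fieldType.

Definition empty_scheme : kscheme k :=
  @KScheme k empty_pre (fun=> tt) empty_is_scheme (@zero_ring_morph k _).

Lemma empty_open (U : set empty_space) : open U.
Proof. by rewrite (_ : U = setT) ?openT//; apply/seteqP; split; case. Qed.

Program Definition empty_mor (X : kscheme k) : mor empty_scheme X :=
  @Mor k empty_scheme X (fun v => match v with end) (fun _ _ => tt) _ _ _ _ _.
Next Obligation. by move=> *; exact: empty_open. Qed.
Next Obligation. by move=> *; exact: zero_ring_morph. Qed.
Next Obligation. by []. Qed.
Next Obligation. by move=> X U s []. Qed.
Next Obligation. by []. Qed.

End EmptyScheme.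

Section ChosenProducts.
Variable k : fieldType.
Implicit Types X Y : kscheme k.

Definition span_over X Y := {P : kscheme k & (mor P X * mor P Y)%type}.

Definition chosen_product X Y : span_over X Y :=
  match pselect (exists d : span_over X Y,
                   is_product (projT2 d).1 (projT2 d).2) with
  | left e => projT1 (cid e)
  | right _ => existT _ (empty_scheme k) (empty_mor X, empty_mor Y)
  end.

Definition prodS X Y : kscheme k := projT1 (chosen_product X Y).
Definition fstS X Y : mor (prodS X Y) X := (projT2 (chosen_product X Y)).1.
Definition sndS X Y : mor (prodS X Y) Y := (projT2 (chosen_product X Y)).2.

End ChosenProducts.

Arguments fstS {k} X Y.
Arguments sndS {k} X Y.

(** * Groups given by generators and relations *)

Section Presentations.

Section Subgroup.
Variable V : zmodType.

Definition subgroup_gen (S : set V) : {pred V} := fun x =>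
  `[< forall H : set V, H 0 -> (forall a b, H a -> H b -> H (a - b)) ->
        S `<=` H -> H x >].

Lemma subgroup_gen_closed S : zmod_closed (subgroup_gen S).
Proof.
split=> [|x y /asboolP hx /asboolP hy]; apply/asboolP => H H0 HB SH //.
by apply: (HB); [exact: hx | exact: hy].
Qed.
HB.instance Definition _ S :=
  GRing.isZmodClosed.Build V (subgroup_gen S) (subgroup_gen_closed S).

(* V / <S> *)
Definition quotient_by (S : set V) : zmodType := Quotient.quot (subgroup_gen S).

Definition quotient_class (S : set V) (x : V) : quotient_by S :=
  \pi_(quotient_by S) x.

End Subgroup.

Section Free.
Variable T : Type.

Definition fin_supp : {pred T -> int} := fun f =>
  `[< finite_set [set t | f t != 0] >].

Lemma fin_supp_closed : zmod_closed fin_supp.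
Proof.
split=> [|f g /asboolP ff /asboolP fg]; apply/asboolP.
  by rewrite (_ : [set _ | _] = set0) //; apply/seteqP; split=> // t /=; rewrite eqxx.
have ffg : finite_set ([set t | f t != 0] `|` [set t | g t != 0]).
  by rewrite finite_setU; split.
apply: sub_finite_set ffg => t /=.
have [ft|ft _] := eqVneq (f t) 0; last by left.
by move=> fgt; right; apply: contraNneq fgt => gt /=; rewrite !fctE /= ft gt.
Qed.
HB.instance Definition _ :=
  GRing.isZmodClosed.Build (T -> int) fin_supp fin_supp_closed.

(* the free abelian group on T *)
Record free_ab := FreeAb { fcoef :> T -> int; fcoefP : fcoef \in fin_supp }.
HB.instance Definition _ := [isSub for fcoef].
HB.instance Definition _ := [Choice of free_ab by <:].
HB.instance Definition _ := [SubChoice_isSubZmodule of free_ab by <:].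

Lemma free_basis_subproof (t : T) :
  (fun t' => (`[< t' = t >] : nat)%:Z) \in fin_supp.
Proof.
apply/asboolP; apply: sub_finite_set (finite_set1 t) => t' /=.
by case: asboolP.
Qed.
Definition free_basis (t : T) : free_ab := FreeAb (free_basis_subproof t).

End Free.
End Presentations.

(** * Finite correspondences and presheaves with transfers *)

Section Correspondences.
Variable k : fieldType.

Record smooth_scheme := Sm {
  sm_sch :> kscheme k;
  sm_smooth : smooth_over_k sm_sch;
  sm_separated : over_k (@separated k) sm_sch;
  sm_ft : over_k (@finite_type k) sm_sch }.

Implicit Types X Y Z : smooth_scheme.

(* An integral closed subscheme is encoded by its generic point.  This says
   that the one with generic point v is finite over X and surjects onto a
   connected component of X. *)
Definition finite_surjective X Y (v : prodS X Y) :=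
  exists V (i : mor V (prodS X Y)),
  [/\ integral_scheme V, closed_immersion i, range i = closure [set v],
      finite_mor (mor_comp (fstS X Y) i)
    & exists x : X,
        range (mor_comp (fstS X Y) i) = connected_component setT x].

Definition is_cor X Y : {pred prodS X Y -> int} := fun a =>
  `[< finite_set [set v | a v != 0] /\
      forall v, a v != 0 -> finite_surjective v >].

Lemma is_cor_closed X Y : zmod_closed (@is_cor X Y).
Proof.
split=> [|a b /asboolP [fa sa] /asboolP [fb sb]]; apply/asboolP.
  split=> [|v]; last by rewrite eqxx.
  by have /asboolP := (fin_supp_closed (prodS X Y)).1.
split=> [|v].
  have : a - b \in @fin_supp (prodS X Y).
    by apply: (fin_supp_closed _).2; apply/asboolP.
  by move/asboolP.
case: (eqVneq (a v) 0) => [av|/sa //].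
case: (eqVneq (b v) 0) => [bv|/sb //].
by rewrite !fctE /= av bv subrr eqxx.
Qed.
HB.instance Definition _ X Y :=
  GRing.isZmodClosed.Build (prodS X Y -> int) (@is_cor X Y) (@is_cor_closed X Y).

Record cor X Y := Cor { cycle :> prodS X Y -> int; cycleP : cycle \in @is_cor X Y }.
HB.instance Definition _ X Y := [isSub for @cycle X Y].
HB.instance Definition _ X Y := [Choice of cor X Y by <:].
HB.instance Definition _ X Y := [SubChoice_isSubZmodule of cor X Y by <:].

(* [kappa(x) : kappa(f x)] = n; a section vanishes in a residue field iff it is
   not invertible at the point *)
Definition is_residue_degree (S T : kscheme k) (f : mor S T) (x : S) (n : nat) :=
  exists U (e : 'I_n -> osh S U), [/\ open U, U x,
    forall V (s : osh S V), open V -> V x ->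
      exists W (c : 'I_n -> osh T W), [/\ open W, W (f x) &
        let O := U `&` V `&` (f @^-1` W) in
        ~ invertible_at x (osr V O s -
            \sum_i osr (f @^-1` W) O (msh f W (c i)) * osr U O (e i))]
  & forall W (c : 'I_n -> osh T W), open W -> W (f x) ->
      let O := U `&` (f @^-1` W) in
      ~ invertible_at x
          (\sum_i osr (f @^-1` W) O (msh f W (c i)) * osr U O (e i)) ->
      forall i, ~ invertible_at (f x) (c i)].

(* the ideal, in the local ring A of W at x, of the inverse image under p of
   the integral closed subscheme with generic point v *)
Definition pulled_ideal (W P : kscheme k) (p : mor W P) (v : P) (x : W)
    (A : comPzRingType) (germ : forall U, osh W U -> A) : set A :=
  ideal_span [set a | exists U (s : osh P U),
    [/\ open U, U (p x), ~ invertible_at v s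
      & a = germ (p @^-1` U) (msh p U s)]].

(* Serre's intersection multiplicity at x of the inverse images of the integral
   closed subschemes with generic points v and w *)
Definition is_intersection_mult (W P Q : kscheme k) (p : mor W P) (q : mor W Q)
    (v : P) (w : Q) (x : W) (n : int) :=
  exists (A : comPzRingType) (germ : forall U, osh W U -> A),
    is_stalk x germ /\
    is_tor_euler_char (pulled_ideal p v x germ) (pulled_ideal q w x germ) n.

(* c = b o a = p13_* (p12^* a . p23^* b): the coefficient of c at u is the sum
   over the components x of the intersections mapping to u *)
Definition is_comp X Y Z (a : cor X Y) (b : cor Y Z) (c : cor X Z) :=
  let p12 := fstS (prodS X Y) Z in
  exists (p23 : mor (prodS (prodS X Y) Z) (prodS Y Z))
         (p13 : mor (prodS (prodS X Y) Z) (prodS X Z)),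
  [/\ mor_eq (mor_comp (fstS Y Z) p23) (mor_comp (sndS X Y) p12)
        /\ mor_eq (mor_comp (sndS Y Z) p23) (sndS (prodS X Y) Z),
      mor_eq (mor_comp (fstS X Z) p13) (mor_comp (fstS X Y) p12)
        /\ mor_eq (mor_comp (sndS X Z) p13) (sndS (prodS X Y) Z)
    & forall u, c u = \sum_(t \in [set t : prodS X Y * prodS Y Z
                                          * prodS (prodS X Y) Z |
          generic_point [set x | closure [set t.1.1] (p12 x) /\
                                 closure [set t.1.2] (p23 x)] t.2
          /\ p13 t.2 = u])
        a t.1.1 * b t.1.2
        * xget 0 [set n | is_intersection_mult p12 p23 t.1.1 t.1.2 t.2 n]
        * (xget 0%N [set n | is_residue_degree p13 t.2 n])%:Z].

(* c is the cycle of the graph of f *)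
Definition is_graph X Y (f : mor X Y) (c : cor X Y) :=
  exists g : mor X (prodS X Y),
  [/\ mor_eq (mor_comp (fstS X Y) g) (mor_id X), mor_eq (mor_comp (sndS X Y) g) f
    & forall v, c v =
        (`[< exists x, generic_point [set: X] x /\ g x = v >] : nat)%:Z].

(* PSh(Cor_k) *)
Record presheaf_with_transfers := PST {
  pst_sections :> smooth_scheme -> zmodType;
  pst_map : forall X Y, cor X Y -> pst_sections Y -> pst_sections X;
  pst_additive : forall X Y (a : cor X Y), zmod_morphism (pst_map a);
  pst_biadditive : forall X Y (s : pst_sections Y),
    zmod_morphism (fun a : cor X Y => pst_map a s);
  pst_id : forall X (a : cor X X) (s : pst_sections X),
    is_graph (mor_id X) a -> pst_map a s = s;
  pst_comp : forall X Y Z (a : cor X Y) (b : cor Y Z) (c : cor X Z)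
    (s : pst_sections Z),
    is_comp a b c -> pst_map c s = pst_map a (pst_map b s) }.

End Correspondences.

(** * Cartier divisors *)

Section Divisors.
Variable k : fieldType.

Section Lemmas.
Variable X : kscheme k.
Implicit Types (U V W : set X).

Lemma osr_morph U V : open U -> open V -> V `<=` U -> ring_morphism (@osr X U V).
Proof. by case: (kpre_scheme X) => -[+ _ _ _ _] _ _; exact. Qed.

Lemma osr_comp U V W (s : osh X U) : open U -> open V -> open W ->
  V `<=` U -> W `<=` V -> osr V W (osr U V s) = osr U W s.
Proof. by case: (kpre_scheme X) => -[_ _ + _ _] _ _; exact. Qed.

Lemma osrM U V (a b : osh X U) : open U -> open V -> V `<=` U ->
  osr U V (a * b) = osr U V a * osr U V b.
Proof. by move=> oU oV VU; have [_ [_ ->]] := osr_morph oU oV VU. Qed.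

Lemma osr1 U V : open U -> open V -> V `<=` U -> osr U V (1 : osh X U) = 1.
Proof. by move=> oU oV VU; have [_ [-> _]] := osr_morph oU oV VU. Qed.

Lemma osrX U V (a : osh X U) n : open U -> open V -> V `<=` U ->
  osr U V (a ^+ n) = osr U V a ^+ n.
Proof.
move=> oU oV VU; elim: n => [|n IH]; first by rewrite !expr0 osr1.
by rewrite !exprS osrM // IH.
Qed.

Lemma regular1 U : open U -> regular_section (1 : osh X U).
Proof. by move=> oU V a oV VU; rewrite osr1 // mul1r. Qed.

Lemma regular_res U V (a : osh X U) : open U -> open V -> V `<=` U ->
  regular_section a -> regular_section (osr U V a).
Proof.
move=> oU oV VU ra W c oW WV; rewrite osr_comp //; apply: ra => //.
exact: subset_trans WV VU.
Qed.

Lemma regularM U (a b : osh X U) : open U ->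
  regular_section a -> regular_section b -> regular_section (a * b).
Proof.
move=> oU ra rb V c oV VU; rewrite osrM // -mulrA => /ra H.
by apply: rb; rewrite ?H.
Qed.

Lemma regularX U (a : osh X U) n : open U ->
  regular_section a -> regular_section (a ^+ n).
Proof.
move=> oU ra; elim: n => [|n IH]; first by rewrite expr0; exact: regular1.
by rewrite exprS; exact: regularM.
Qed.

End Lemmas.

Lemma is_unitM (A : comPzRingType) (a b : A) :
  is_unit a -> is_unit b -> is_unit (a * b).
Proof.
move=> [c ac] [d bd]; exists (c * d).
by rewrite mulrACA ac bd mulr1.
Qed.

Lemma is_unitX (A : comPzRingType) (a : A) n : is_unit a -> is_unit (a ^+ n).
Proof. by move=> [c ac]; exists (c ^+ n); rewrite -exprMn ac expr1n. Qed.

Lemma is_unit_res (X : kscheme k) (U V : set X) (a : osh X U) :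
  open U -> open V -> V `<=` U -> is_unit a -> is_unit (osr U V a).
Proof.
by move=> oU oV VU [c ac]; exists (osr U V c); rewrite -osrM // ac osr1.
Qed.

Implicit Types X Y : kscheme k.

(* A Cartier divisor, i.e. a global section of K^* / O^* (K the sheaf of total
   quotient rings): near x it is given by the fraction cnum x / cden x of
   regular sections, and these fractions agree up to units on overlaps.
   Equality of divisors is cd_eq below. *)
Record cdiv X := CDiv {
  cdom : X -> set X;
  cnum : forall x, osh X (cdom x);
  cden : forall x, osh X (cdom x);
  cdom_open : forall x, open (cdom x);
  cdom_mem : forall x, cdom x x;
  cnum_reg : forall x, regular_section (cnum x);
  cden_reg : forall x, regular_section (cden x);
  cdiv_compat : forall x y, let W := cdom x `&` cdom y in
    exists u : osh X W, is_unit u /\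
      osr (cdom x) W (cnum x) * osr (cdom y) W (cden y)
      = u * (osr (cdom y) W (cnum y) * osr (cdom x) W (cden x)) }.

(* a / b is a local equation of D on V *)
Definition local_eq X (D : cdiv X) V (a b : osh X V) :=
  [/\ open V, regular_section a, regular_section b
    & forall x, V x -> exists W (u : osh X W),
        [/\ open W, W x, W `<=` V `&` cdom D x, is_unit u
          & osr V W a * osr (cdom D x) W (cden D x)
            = u * (osr (cdom D x) W (cnum D x) * osr V W b)]].

Definition cd_eq X (D E : cdiv X) := forall x, exists V (a b : osh X V),
  [/\ V x, local_eq D a b & local_eq E a b].

Program Definition cd_add X (D E : cdiv X) : cdiv X :=
  @CDiv X (fun x => cdom D x `&` cdom E x)
    (fun x => osr (cdom D x) _ (cnum D x) * osr (cdom E x) _ (cnum E x))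
    (fun x => osr (cdom D x) _ (cden D x) * osr (cdom E x) _ (cden E x))
    _ _ _ _ _.
Next Obligation. by move=> X D E x; apply: openI; exact: cdom_open. Qed.
Next Obligation. by move=> X D E x; split; exact: cdom_mem. Qed.
Next Obligation.
move=> X D E x; have o := openI (cdom_open D x) (cdom_open E x).
by apply: regularM => //; apply: regular_res => //; do ?exact: cdom_open;
  exact: cnum_reg.
Qed.
Next Obligation.
move=> X D E x; have o := openI (cdom_open D x) (cdom_open E x).
by apply: regularM => //; apply: regular_res => //; do ?exact: cdom_open;
  exact: cden_reg.
Qed.
Next Obligation.
move=> X D E x y /=.
have oD := cdom_open D; have oE := cdom_open E.
set W := (X in osh _ X).
have oW : open W by do !apply: openI.
have [u [uu eu]] := cdiv_compat D x y; have [v [uv ev]] := cdiv_compat E x y.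
have oDD := openI (oD x) (oD y); have oEE := openI (oE x) (oE y).
have WD : W `<=` cdom D x `&` cdom D y by move=> z [[? ?] [? ?]].
have WE : W `<=` cdom E x `&` cdom E y by move=> z [[? ?] [? ?]].
exists (osr _ W u * osr _ W v); split.
  by apply: is_unitM; exact: is_unit_res.
have {}eu := congr1 (osr _ W) eu; have {}ev := congr1 (osr _ W) ev.
rewrite !osrM ?osr_comp // in eu; rewrite !osrM ?osr_comp // in ev;
  do ?by move=> z [].
rewrite !osrM ?osr_comp //; do ?[by apply: openI | by move=> z []].
by rewrite mulrACA eu ev [LHS]mulrACA; congr (_ * _); rewrite mulrACA.
Qed.

Program Definition cd_opp X (D : cdiv X) : cdiv X :=
  @CDiv X (cdom D) (cden D) (cnum D) (cdom_open D) (cdom_mem D)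
    (@cden_reg X D) (@cnum_reg X D) _.
Next Obligation.
move=> X D x y /=; have [u [[v uv] eu]] := cdiv_compat D x y.
exists v; split; first by exists u; rewrite mulrC.
by rewrite [LHS]mulrC [X in _ = v * X]mulrC eu mulrA [v * u]mulrC uv mul1r.
Qed.

Program Definition cd_muln X (n : nat) (D : cdiv X) : cdiv X :=
  @CDiv X (cdom D) (fun x => cnum D x ^+ n) (fun x => cden D x ^+ n)
    (cdom_open D) (cdom_mem D) _ _ _.
Next Obligation.
by move=> X n D x; apply: regularX; [exact: cdom_open | exact: cnum_reg].
Qed.
Next Obligation.
by move=> X n D x; apply: regularX; [exact: cdom_open | exact: cden_reg].
Qed.
Next Obligation.
move=> X n D x y /=; have [u [uu eu]] := cdiv_compat D x y.
have oD := cdom_open D; have oDD := openI (oD x) (oD y).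
exists (u ^+ n); split; first exact: is_unitX.
by rewrite !osrX //; do ?[by move=> z []]; rewrite -!exprMn eu.
Qed.

(* the local equation of D at x belongs to the local ring of X at x *)
Definition cd_effective X (D : cdiv X) := forall x, exists V (h : osh X V),
  [/\ open V, V x, V `<=` cdom D x
    & osr (cdom D x) V (cnum D x) = h * osr (cdom D x) V (cden D x)].

(* the points x where the local equation of D is not a unit of the local ring *)
Definition cd_support X (D : cdiv X) : set X :=
  [set x | ~ exists V (h : osh X V),
    [/\ open V, V x, V `<=` cdom D x, is_unit h
      & osr (cdom D x) V (cnum D x) = h * osr (cdom D x) V (cden D x)]].

(* E is the pullback of D along f; it exists only when D has, locally, equations
   whose pullbacks are regular *)
Definition cd_is_pullback Y X (f : mor Y X) (D : cdiv X) (E : cdiv Y) :=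
  forall y, exists V (a b : osh X V),
    [/\ V (f y), local_eq D a b & local_eq E (msh f V a) (msh f V b)].

(* CDiv(X) (x) Q: the pair (D, n) stands for D (x) 1/(n + 1), and equality is
   that of the localization of the abelian group CDiv(X) at the positive
   integers. *)
Definition qcdiv X := (cdiv X * nat)%type.

Definition qcd_eq X (D E : qcdiv X) := exists N,
  cd_eq (cd_muln (N.+1 * E.2.+1) D.1) (cd_muln (N.+1 * D.2.+1) E.1).

Definition qcd_add X (D E : qcdiv X) : qcdiv X :=
  (cd_add (cd_muln E.2.+1 D.1) (cd_muln D.2.+1 E.1), (D.2.+1 * E.2.+1).-1).

Definition qcd_opp X (D : qcdiv X) : qcdiv X := (cd_opp D.1, D.2).

Definition qcd_is_pullback Y X (f : mor Y X) (D : qcdiv X) (E : qcdiv Y) :=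
  exists C C' n, [/\ qcd_eq D (C, n), cd_is_pullback f C C' & qcd_eq E (C', n)].

Inductive coefficient_ring := LambdaZ | LambdaQ.

Implicit Type L : coefficient_ring.

Definition ldiv L X : Type := match L with LambdaZ => cdiv X | LambdaQ => qcdiv X end.

Definition ldiv_of_cdiv L X (D : cdiv X) : ldiv L X :=
  match L with LambdaZ => D | LambdaQ => (D, 0%N) end.

Definition ldiv_eq L X : ldiv L X -> ldiv L X -> Prop :=
  match L with LambdaZ => @cd_eq X | LambdaQ => @qcd_eq X end.

Definition ldiv_add L X : ldiv L X -> ldiv L X -> ldiv L X :=
  match L with LambdaZ => @cd_add X | LambdaQ => @qcd_add X end.

Definition ldiv_opp L X : ldiv L X -> ldiv L X :=
  match L with LambdaZ => @cd_opp X | LambdaQ => @qcd_opp X end.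

Definition ldiv_muln L X (n : nat) : ldiv L X -> ldiv L X :=
  match L with
  | LambdaZ => @cd_muln X n
  | LambdaQ => fun D => (cd_muln n D.1, D.2)
  end.

Definition ldiv_is_pullback L Y X (f : mor Y X) :
    ldiv L X -> ldiv L Y -> Prop :=
  match L with
  | LambdaZ => cd_is_pullback f
  | LambdaQ => qcd_is_pullback f
  end.

(* D is L-effective with support S; in the rational case D = r E with E an
   effective Cartier divisor and r = p / (q + 1) a positive rational *)
Definition effective_with_support L X : ldiv L X -> set X -> Prop :=
  match L with
  | LambdaZ => fun D S => cd_effective D /\ S = cd_support D
  | LambdaQ => fun D S => exists E p q,
      [/\ cd_effective E, (0 < p)%N, qcd_eq D (cd_muln p E, q)
        & S = cd_support E]
  end.

Definition ldiv_le L X (D D' : ldiv L X) :=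
  exists S, effective_with_support (ldiv_add D' (ldiv_opp D)) S.

(** Multiples of effective divisors *)

Lemma local_eq_muln X (D : cdiv X) V (a b : osh X V) n :
  local_eq D a b -> local_eq (cd_muln n D) (a ^+ n) (b ^+ n).
Proof.
move=> [oV ra rb h]; split=> //; do ?exact: regularX.
move=> x Vx; have [W [u [oW Wx WV uu e]]] := h x Vx.
have oD := cdom_open D x.
have WV' : W `<=` V by move=> y /WV [].
have WD : W `<=` cdom D x by move=> y /WV [].
exists W, (u ^+ n); split=> //; first exact: is_unitX.
by rewrite /= !osrX // -!exprMn e.
Qed.

Lemma local_eq_mulnM X (D : cdiv X) V (a b : osh X V) m n :
  local_eq (cd_muln m (cd_muln n D)) a b <-> local_eq (cd_muln (n * m) D) a b.
Proof.
by split=> -[oV ra rb h]; split=> // x Vx; have [W [u [oW Wx WV uu e]]] := h x Vx;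
  exists W, u; split=> //; move: e; rewrite /= -!exprM.
Qed.

Lemma cd_effective_muln X (D : cdiv X) n :
  cd_effective D -> cd_effective (cd_muln n D).
Proof.
move=> eff x; have [V [h [oV Vx VD e]]] := eff x; exists V, (h ^+ n); split=> //.
by have oD := cdom_open D x; rewrite /= !osrX // e exprMn.
Qed.

Lemma cd_support_muln X (D : cdiv X) n : cd_effective D ->
  cd_support (cd_muln n.+1 D) = cd_support D.
Proof.
move=> eff; apply/seteqP; split=> x /= hx; have oD := cdom_open D x;
  move=> [V [u [oV Vx VD uu e]]]; apply: hx.
  exists V, (u ^+ n.+1); split=> //; first exact: is_unitX.
  by rewrite /= !osrX // e exprMn.
have [V' [h [oV' V'x V'D e']]] := eff x.
have oO := openI oV oV'; set O := V `&` V' in oO.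
have OV : O `<=` V by move=> y [].
have OV' : O `<=` V' by move=> y [].
have OD : O `<=` cdom D x by move=> y /OV /VD.
have {}e := congr1 (osr V O) e; have {}e' := congr1 (osr V' O) e'.
rewrite /= osrM // !osr_comp // !osrX // in e.
rewrite osrM // !osr_comp // in e'.
exists O, (osr V' O h); split=> //.
have [w we] : is_unit (osr V O u) by exact: is_unit_res.
have rn := regularX (n := n.+1) oD (@cden_reg _ D x).
exists (osr V' O h ^+ n * w); rewrite mulrA -exprS.
rewrite (_ : osr V' O h ^+ n.+1 = osr V O u) //.
apply/eqP; rewrite -subr_eq0; apply/eqP; apply: (rn O) => //.
by rewrite osrX // mulrC mulrBl -e e' exprMn subrr.
Qed.

Lemma effective_with_support_muln L X (D : ldiv L X) S n :
  effective_with_support D S -> effective_with_support (ldiv_muln n.+1 D) S.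
Proof.
case: L D => [D [eff ->]|[D m] /= [E [p [q [eff p0 [N e] ->]]]]].
  by split; [exact: cd_effective_muln | rewrite cd_support_muln].
exists E, (p * n.+1)%N, q; split=> //; first by rewrite muln_gt0 p0.
exists N => x; have [V [a [b [Vx e1 e2]]]] := e x.
exists V, (a ^+ n.+1), (b ^+ n.+1); split=> //.
  have /local_eq_mulnM h := local_eq_muln n.+1 e1.
  by apply/local_eq_mulnM; rewrite mulnC.
have /local_eq_mulnM/local_eq_mulnM h := local_eq_muln n.+1 e2.
by apply/local_eq_mulnM; rewrite mulnAC -mulnA.
Qed.

Lemma local_eq_self X (D : cdiv X) x : local_eq D (cnum D x) (cden D x).
Proof.
have oD := cdom_open D; split=> //; [exact: cnum_reg|exact: cden_reg|].
move=> y Dxy; have [u [uu e]] := cdiv_compat D x y.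
exists (cdom D x `&` cdom D y), u; split=> //; first exact: openI.
by split=> //; exact: cdom_mem.
Qed.

Lemma effective_with_support_of_cdiv L X (E : cdiv X) : cd_effective E ->
  effective_with_support (ldiv_of_cdiv L E) (cd_support E).
Proof.
case: L => eff /=; first by split.
exists E, 1%N, 0%N; split=> //; exists 0%N => x.
exists (cdom E x), (cnum E x), (cden E x); split; first exact: cdom_mem.
  have := local_eq_muln 1 (local_eq_self E x); rewrite !expr1.
  by rewrite !mul1n.
have := local_eq_muln 1 (local_eq_self E x); rewrite !expr1 => h.
by apply/local_eq_mulnM; rewrite !mul1n.
Qed.

End Divisors.

(** * Modulus pairs *)

Section ModulusPairs.
Variable k : fieldType.
Implicit Types (S : smooth_scheme k) (L : coefficient_ring).

(* A proper L-modulus pair (X, D_X), together with its interior: S is a smooth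
   scheme identified by mp_j with the open subscheme X \ |D_X|. *)
Record modulus_pair L S := ModulusPair {
  mp_sch : kscheme k;
  mp_proper : over_k (@proper k) mp_sch;
  mp_div : ldiv L mp_sch;
  mp_j : mor S mp_sch;
  mp_open : open_immersion mp_j;
  mp_support : effective_with_support mp_div (~` range mp_j) }.

(* (X, m D_X), with m = n + 1 > 0 *)
Definition mp_mul L S (n : nat) (T : modulus_pair L S) : modulus_pair L S :=
  @ModulusPair L S (mp_sch T) (mp_proper T) (ldiv_muln n.+1 (mp_div T)) (mp_j T)
    (mp_open T) (effective_with_support_muln n (mp_support T)).

(* The condition on the component of a correspondence with generic point v: V is
   the closure of its image in X x X', and N is the normalization of V. *)
Definition admissible L S S' (T : modulus_pair L S) (T' : modulus_pair L S')
    (v : prodS S S') :=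
  let X := mp_sch T in let X' := mp_sch T' in
  exists (jj : mor (prodS S S') (prodS X X')) V (i : mor V (prodS X X'))
         N (nu : mor N V),
  [/\ mor_eq (mor_comp (fstS X X') jj) (mor_comp (mp_j T) (fstS S S'))
        /\ mor_eq (mor_comp (sndS X X') jj) (mor_comp (mp_j T') (sndS S S')),
      [/\ integral_scheme V, closed_immersion i & range i = closure [set jj v]],
      proper (mor_comp (fstS X X') i),
      is_normalization nu
    & exists E E',
        [/\ ldiv_is_pullback (mor_comp (fstS X X') (mor_comp i nu)) (mp_div T) E,
            ldiv_is_pullback (mor_comp (sndS X X') (mor_comp i nu)) (mp_div T') E'
          & ldiv_le E' E]].

Definition is_mcor L S S' (T : modulus_pair L S) (T' : modulus_pair L S') :
    {pred cor S S'} :=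
  fun a => `[< forall v, a v != 0 -> admissible T T' v >].

Lemma is_mcor_closed L S S' (T : modulus_pair L S) (T' : modulus_pair L S') :
  zmod_closed (is_mcor T T').
Proof.
split=> [|a b /asboolP ha /asboolP hb]; apply/asboolP => v.
  by rewrite (_ : (0 : cor S S') v = 0) ?eqxx.
rewrite (_ : (a - b) v = a v - b v) //.
case: (eqVneq (a v) 0) => [av|/ha //].
case: (eqVneq (b v) 0) => [bv|/hb //].
by rewrite av bv subrr eqxx.
Qed.
HB.instance Definition _ L S S' (T : modulus_pair L S) (T' : modulus_pair L S') :=
  GRing.isZmodClosed.Build (cor S S') (is_mcor T T') (is_mcor_closed T T').

(* the group of morphisms from T to T' in MCor *)
Record mcor L S S' (T : modulus_pair L S) (T' : modulus_pair L S') :=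
  MCor { mcycle :> cor S S'; mcycleP : mcycle \in is_mcor T T' }.
HB.instance Definition _ L S S' (T : modulus_pair L S) (T' : modulus_pair L S') :=
  [isSub for @mcycle L S S' T T'].
HB.instance Definition _ L S S' (T : modulus_pair L S) (T' : modulus_pair L S') :=
  [Choice of mcor T T' by <:].
HB.instance Definition _ L S S' (T : modulus_pair L S) (T' : modulus_pair L S') :=
  [SubChoice_isSubZmodule of mcor T T' by <:].

(* T'' is the tensor product of T and T', with projections p and q *)
Definition is_tensor L S S' S'' (T : modulus_pair L S) (T' : modulus_pair L S')
    (T'' : modulus_pair L S'') (p : mor (mp_sch T'') (mp_sch T))
    (q : mor (mp_sch T'') (mp_sch T')) :=
  is_product p q /\
  exists E E', [/\ ldiv_is_pullback p (mp_div T) E,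
                   ldiv_is_pullback q (mp_div T') E'
                 & ldiv_eq (mp_div T'') (ldiv_add E E')].

(* The projective line with its divisor at infinity: two affine lines with
   coordinates t and s are glued by t s = 1, and infinity is the point s = 0.
   The interior cb_int is the affine line. *)
Record cube := Cube {
  cb_P1 : kscheme k;
  cb_proper : over_k (@proper k) cb_P1;
  cb_U0 : set cb_P1;
  cb_U1 : set cb_P1;
  cb_t : osh cb_P1 cb_U0;
  cb_s : osh cb_P1 cb_U1;
  cb_cover : cb_U0 `|` cb_U1 = setT;
  cb_affine0 : affine_open cb_U0;
  cb_affine1 : affine_open cb_U1;
  cb_poly0 : bijective (fun p : {poly k} =>
    \sum_(i < size p) osr setT cb_U0 (kstr cb_P1 p`_i) * cb_t ^+ i);
  cb_poly1 : bijective (fun p : {poly k} =>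
    \sum_(i < size p) osr setT cb_U1 (kstr cb_P1 p`_i) * cb_s ^+ i);
  cb_overlap0 : basic_open cb_t = cb_U0 `&` cb_U1;
  cb_overlap1 : basic_open cb_s = cb_U0 `&` cb_U1;
  cb_glue : osr cb_U0 (cb_U0 `&` cb_U1) cb_t * osr cb_U1 (cb_U0 `&` cb_U1) cb_s
            = 1;
  cb_inf : cdiv cb_P1;
  cb_inf_eff : cd_effective cb_inf;
  cb_inf0 : local_eq cb_inf (1 : osh cb_P1 cb_U0) 1;
  cb_inf1 : local_eq cb_inf cb_s 1;
  cb_int : smooth_scheme k;
  cb_j : mor cb_int cb_P1;
  cb_open : open_immersion cb_j;
  cb_support : ~` range cb_j = cd_support cb_inf }.

Arguments cb_U0 : clear implicits.
Arguments cb_U1 : clear implicits.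

Lemma box_support L (C : cube) : effective_with_support
  (ldiv_of_cdiv L (cb_inf C)) (~` range (cb_j C)).
Proof.
by rewrite cb_support; apply: effective_with_support_of_cdiv; exact: cb_inf_eff.
Qed.

Definition box L (C : cube) : modulus_pair L (cb_int C) :=
  ModulusPair (cb_proper C) (cb_open C) (box_support L C).

(* f is the constant morphism to the k-point t = c of the projective line *)
Definition is_constant (C : cube) (X : kscheme k) (f : mor X (cb_P1 C)) (c : k) :=
  (forall x, cb_U0 C (f x)) /\
  msh f (cb_U0 C) (cb_t C) = osr setT (f @^-1` cb_U0 C) (kstr X c).

(* delta is id_T (x) i_c, where i_c is the section of the cube at the point c *)
Definition is_cube_section L S S' (C : cube) (T : modulus_pair L S)
    (T' : modulus_pair L S') (p : mor (mp_sch T') (mp_sch T))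
    (q : mor (mp_sch T') (cb_P1 C)) (c : k) (delta : mcor T T') :=
  exists g : mor S S',
    [/\ mor_eq (mor_comp p (mor_comp (mp_j T') g)) (mp_j T),
        is_constant (mor_comp q (mor_comp (mp_j T') g)) c
      & is_graph g delta].

(** * Presheaves on MCor, h_0 and the left Kan extension to Cor *)

(* A presheaf on MCor, with the action of a correspondence given by its graph:
   mpsh_act delta x y means delta^* x = y.  With this encoding the quotient
   presheaves below do not depend on a proof that MCor is a category. *)
Record mpresheaf L := MPresheaf {
  mpsh_sections :> forall S, modulus_pair L S -> zmodType;
  mpsh_act : forall S S' (T : modulus_pair L S) (T' : modulus_pair L S'),
    mcor T T' -> mpsh_sections T' -> mpsh_sections T -> Prop }.

Definition yoneda L S0 (Y : modulus_pair L S0) : mpresheaf L :=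
  @MPresheaf L (fun S T => mcor T Y)
    (fun S S' T T' delta x y => is_comp delta x y).

(* the image of i_0^* - i_1^* : G(T (x) box) -> G(T) *)
Definition cube_differences L (G : mpresheaf L) S (T : modulus_pair L S) :
    set (G S T) :=
  [set y | exists (C : cube) S' (T' : modulus_pair L S')
      (p : mor (mp_sch T') (mp_sch T)) (q : mor (mp_sch T') (mp_sch (box L C)))
      (i0 i1 : mcor T T') (x : G S' T') (y0 y1 : G S T),
    [/\ is_tensor p q,
        is_cube_section p q 0 i0 /\ is_cube_section p q 1 i1,
        mpsh_act i0 x y0, mpsh_act i1 x y1 & y = y0 - y1]].

Definition h0_cube L (G : mpresheaf L) : mpresheaf L :=
  @MPresheaf L (fun S T => quotient_by (@cube_differences L G S T))
    (fun S S' T T' delta xi eta => exists x y,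
      [/\ quotient_class _ x = xi, quotient_class _ y = eta
        & mpsh_act delta x y]).

(* omega_! G (S) as the colimit over m > 0 of G(X, m D_X), computed with the
   compactification T = (X, D_X) of S; the pair (n, x) stands for the class of
   x in G(X, (n + 1) D_X), and the transition maps are the pullbacks along the
   identity correspondence of S. *)
Definition kan_generators L (G : mpresheaf L) S (T : modulus_pair L S) :=
  {n : nat & G S (mp_mul n T)}.

Definition kan_basis L (G : mpresheaf L) S (T : modulus_pair L S) n
    (x : G S (mp_mul n T)) : free_ab (kan_generators G T) :=
  free_basis (existT (fun n => G S (mp_mul n T)) n x).

Definition kan_relations L (G : mpresheaf L) S (T : modulus_pair L S) :
    set (free_ab (kan_generators G T)) :=
  [set r | exists n (x y : G S (mp_mul n T)),
      r = kan_basis (x + y) - kan_basis x - kan_basis y] `|`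
  [set r | exists m n (x : G S (mp_mul m T)) (y : G S (mp_mul n T))
      (delta : mcor (mp_mul n T) (mp_mul m T)),
    [/\ (m <= n)%N, is_graph (mor_id S) delta, mpsh_act delta x y
      & r = kan_basis x - kan_basis y]].

Definition omega_shriek L (G : mpresheaf L) S (T : modulus_pair L S) : zmodType :=
  quotient_by (@kan_relations L G S T).

Definition kan_class L (G : mpresheaf L) S (T : modulus_pair L S) n
    (x : G S (mp_mul n T)) : omega_shriek G T :=
  quotient_class _ (kan_basis x).

(* a^* xi = eta, for a in Cor(S', S), xi in omega_! G (S), eta in omega_! G (S');
   this determines a^* since every element is of the form kan_class x.  For
   S = S' and a the identity it is the canonical identification of the groups
   computed with two compactifications of S. *)
Definition omega_act L (G : mpresheaf L) S S' (T : modulus_pair L S)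
    (T' : modulus_pair L S') (a : cor S' S)
    (xi : omega_shriek G T) (eta : omega_shriek G T') :=
  exists m n (x : G S (mp_mul m T)) (y : G S' (mp_mul n T'))
    (delta : mcor (mp_mul n T') (mp_mul m T)),
  [/\ xi = kan_class x, eta = kan_class y, mcycle delta = a
    & mpsh_act delta x y].

(* h_0(Y), on the object S with compactification T *)
Definition h0 L S0 (Y : modulus_pair L S0) S (T : modulus_pair L S) : zmodType :=
  omega_shriek (h0_cube (yoneda Y)) T.

(* the canonical epimorphism Z_tr(S0) -> h_0(Y) sends b in Cor(S, S0) to xi *)
Definition h0_projection L S0 (Y : modulus_pair L S0) S (T : modulus_pair L S)
    (b : cor S S0) (xi : h0 Y T) :=
  exists n (x : mcor (mp_mul n T) Y),
    mcycle x = b /\ xi = kan_class (G := h0_cube (yoneda Y)) (quotient_class _ x).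

(** * Reciprocity *)

Variable F : presheaf_with_transfers k.

(* phi is a morphism h_0(Y) -> F of presheaves with transfers whose composite
   with Z_tr(S) -> h_0(Y) is the morphism Z_tr(S) -> F, b |-> b^* a *)
Definition is_modulus L S (a : F S) (Y : modulus_pair L S) :=
  exists phi : forall S' (T : modulus_pair L S'), h0 Y T -> F S',
  [/\ forall S' (T : modulus_pair L S'), zmod_morphism (phi S' T),
      forall S1 S2 (T1 : modulus_pair L S1) (T2 : modulus_pair L S2)
        (b : cor S2 S1) (xi : h0 Y T1) (eta : h0 Y T2),
        omega_act b xi eta -> phi S2 T2 eta = pst_map b (phi S1 T1 xi)
    & forall S' (T : modulus_pair L S') (b : cor S' S) (xi : h0 Y T),
        h0_projection b xi -> phi S' T xi = pst_map b a].

(* membership in RSC^L *)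
Definition reciprocity L :=
  forall S (a : F S), exists Y : modulus_pair L S, is_modulus a Y.

End ModulusPairs.

(* Main.v *)
(* If D_X = r E with E an effective Cartier divisor and r a
   positive rational, then numerator(r) E is an integral divisor with the same
   support, and it is a multiple >= 1 of D_X; enlarging the modulus of the source
   and shrinking that of the target preserves admissibility.  The admissibility
   condition is an inequality between pullbacks to a normal scheme, and there a
   Cartier divisor with an effective multiple is effective, so that an inequality
   of Cartier divisors with rational coefficients holds with integral ones.  This
   turns each relation defining h_0 of an integral (resp. rational) modulus pair
   into a relation for the other coefficient ring, and a modulus for one ring
   yields one for the other. *)
Require Import Defs.
From HB Require Import structures.
From mathcomp Require Import all_boot all_order all_algebra.
From mathcomp Require Import generic_quotient ring_quotient.
From mathcomp Require Import all_classical topology.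
From mathcomp Require Import ring zify.
Set Implicit Arguments.
Unset Strict Implicit.
Unset Printing Implicit Defensive.
Import GRing.Theory.
Local Open Scope classical_set_scope.
Local Open Scope ring_scope.
Local Open Scope quotient_scope.

(** * Fractions of nonzerodivisors modulo units *)

(** The delicate point is the cube. When a modulus [c / (n+1)] is replaced by [c], its tensor
    product with the cube changes from [u / (n+1) + v] to [u + v], where [u] and [v] are the
    pullbacks of [c] and of infinity: the coefficient of infinity has to stay 1, so the tensor
    product is not simply multiplied by [n+1]. Every arrow of a relation must survive this. The two
    sections do, because [c / (n+1) >= u / (n+1) + v] gives [c >= u + (n+1) v >= u + v]; the
    homotopy does, because [u + v >= u / (n+1) + v]. A second obstacle is that Cartier divisors pull
    back only when their equations stay regular, and a rational divisor is pulled back through some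
    integral representative of a multiple. Effectivity settles this: a factor of a nonzerodivisor is
    a nonzerodivisor, so the effective summands of a divisor that has a pullback have pullbacks
    too. *)

Section DivisorGroup.
Variable A : comPzRingType.
Implicit Types a b c d u : A.

Lemma is_unit1 : is_unit (1 : A).
Proof. by exists 1; rewrite mul1r. Qed.

Lemma is_unitV u v : u * v = 1 -> is_unit v.
Proof. by move=> uv; exists u; rewrite mulrC. Qed.

Lemma is_unit_lreg u : is_unit u -> GRing.lreg u.
Proof.
move=> [v uv] a b /(congr1 ( *%R v)).
by rewrite !mulrA [v * u]mulrC uv !mul1r.
Qed.

Lemma lregMr a b : GRing.lreg (a * b) -> GRing.lreg a.
Proof. by rewrite mulrC; exact: GRing.lregMl. Qed.

Record fracpair := FracPair {
  fnum : A; fden : A;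
  fnumP : GRing.lreg fnum; fdenP : GRing.lreg fden }.
Arguments fnumP : clear implicits.
Arguments fdenP : clear implicits.
HB.instance Definition _ := gen_eqMixin fracpair.
HB.instance Definition _ := gen_choiceMixin fracpair.

Definition frac_equiv (x y : fracpair) :=
  `[< exists u, is_unit u /\ fnum x * fden y = u * (fnum y * fden x) >].

Lemma frac_equiv_refl : reflexive frac_equiv.
Proof.
by move=> x; apply/asboolP; exists 1; rewrite mul1r; split=> //; exact: is_unit1.
Qed.

Lemma frac_equiv_sym : symmetric frac_equiv.
Proof.
suff h x y : frac_equiv x y -> frac_equiv y x by move=> x y; apply/idP/idP; exact: h.
move=> /asboolP [u [[v uv] e]]; apply/asboolP; exists v.
by split; [exact: is_unitV uv | rewrite e mulrA [v * u]mulrC uv mul1r].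
Qed.

Lemma frac_equiv_trans : transitive frac_equiv.
Proof.
move=> y x z /asboolP [u [uu e]] /asboolP [v [uv e']]; apply/asboolP.
exists (u * v); split; first exact: is_unitM.
apply: (fdenP y).
have -> : fden y * (fnum x * fden z) = fnum x * fden y * fden z by ring.
have -> : fden y * (u * v * (fnum z * fden x)) =
  u * fden x * (v * (fnum z * fden y)) by ring.
by rewrite e -e'; ring.
Qed.

Canonical frac_equiv_equiv :=
  EquivRel frac_equiv frac_equiv_refl frac_equiv_sym frac_equiv_trans.

(** The units of the total ring of fractions of [A] modulo the units of [A], written additively
    below. With [A] a stalk, germs of Cartier divisors live here. This group can have torsion. *)
Definition divgrp := {eq_quot frac_equiv}.
HB.instance Definition _ : EqQuotient _ frac_equiv divgrp := EqQuotient.on divgrp.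
HB.instance Definition _ := Choice.on divgrp.

(* the class of a / b; junk unless a and b are nonzerodivisors *)
Definition divclass a b : divgrp :=
  match pselect (GRing.lreg a), pselect (GRing.lreg b) with
  | left ra, left rb => \pi_divgrp (FracPair ra rb)
  | _, _ => \pi_divgrp (FracPair (@GRing.lreg1 A) (@GRing.lreg1 A))
  end.

Lemma divclassE a b (ra : GRing.lreg a) (rb : GRing.lreg b) :
  divclass a b = \pi_divgrp (FracPair ra rb).
Proof.
rewrite /divclass; case: pselect => // ra'; case: pselect => // rb'.
by rewrite (Prop_irrelevance ra' ra) (Prop_irrelevance rb' rb).
Qed.

Lemma frac_num_den (x : fracpair) : divclass (fnum x) (fden x) = \pi_divgrp x.
Proof. by rewrite (divclassE (fnumP x) (fdenP x)); case: x. Qed.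

Lemma divclassP (g : divgrp) :
  exists a b, [/\ GRing.lreg a, GRing.lreg b & g = divclass a b].
Proof.
elim/quotW: g => x; exists (fnum x), (fden x).
by split; [exact: fnumP | exact: fdenP | rewrite frac_num_den].
Qed.

Lemma divclass_eq a b c d : GRing.lreg a -> GRing.lreg b -> GRing.lreg c ->
  GRing.lreg d ->
  divclass a b = divclass c d <-> exists u, is_unit u /\ a * d = u * (c * b).
Proof.
move=> ra rb rc rd; rewrite (divclassE ra rb) (divclassE rc rd).
by split=> [/eqmodP/asboolP|?] //; apply/eqmodP/asboolP.
Qed.

Definition addp (x y : fracpair) :=
  FracPair (GRing.lregM (fnumP x) (fnumP y)) (GRing.lregM (fdenP x) (fdenP y)).
Definition oppp (x : fracpair) := FracPair (fdenP x) (fnumP x).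

Definition divgrp_zero : divgrp := divclass 1 1.
Definition divgrp_add (g h : divgrp) : divgrp := \pi_divgrp (addp (repr g) (repr h)).
Definition divgrp_opp (g : divgrp) : divgrp := \pi_divgrp (oppp (repr g)).

Lemma repr_divclass a b : GRing.lreg a -> GRing.lreg b -> exists u,
  is_unit u /\ fnum (repr (divclass a b)) * b = u * (a * fden (repr (divclass a b))).
Proof.
move=> ra rb; apply/divclass_eq => //; do ?[exact: fnumP | exact: fdenP].
by rewrite frac_num_den reprK.
Qed.

Lemma divgrp_addE a b c d : GRing.lreg a -> GRing.lreg b -> GRing.lreg c ->
  GRing.lreg d -> divgrp_add (divclass a b) (divclass c d) = divclass (a * c) (b * d).
Proof.
move=> ra rb rc rd; have [u [uu e]] := repr_divclass ra rb.
have [v [uv e']] := repr_divclass rc rd.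
rewrite /divgrp_add -frac_num_den; apply/divclass_eq;
  do ?[exact: fnumP | exact: fdenP | exact: GRing.lregM].
by exists (u * v); split; [exact: is_unitM | rewrite /= mulrACA e e'; ring].
Qed.

Lemma divgrp_oppE a b : GRing.lreg a -> GRing.lreg b ->
  divgrp_opp (divclass a b) = divclass b a.
Proof.
move=> ra rb; have [u [[v uv] e]] := repr_divclass ra rb.
rewrite /divgrp_opp -frac_num_den; apply/divclass_eq => //;
  do ?[exact: fnumP | exact: fdenP].
exists v; split; first exact: is_unitV uv.
by rewrite /= [b * _]mulrC e mulrA [v * u]mulrC uv mul1r mulrC.
Qed.

Lemma divgrp_addA : associative divgrp_add.
Proof.
move=> g h l; have [a [b [ra rb ->]]] := divclassP g.
have [c [d [rc rd ->]]] := divclassP h; have [e [f [re rf ->]]] := divclassP l.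
by rewrite !divgrp_addE ?mulrA //; apply: GRing.lregM.
Qed.

Lemma divgrp_addC : commutative divgrp_add.
Proof.
move=> g h; have [a [b [ra rb ->]]] := divclassP g.
have [c [d [rc rd ->]]] := divclassP h.
by rewrite !divgrp_addE // [c * a]mulrC [d * b]mulrC.
Qed.

Lemma divgrp_add0 : left_id divgrp_zero divgrp_add.
Proof.
move=> g; have [a [b [ra rb ->]]] := divclassP g.
by rewrite /divgrp_zero divgrp_addE ?mul1r //; exact: GRing.lreg1.
Qed.

Lemma divgrp_addN : left_inverse divgrp_zero divgrp_opp divgrp_add.
Proof.
move=> g; have [a [b [ra rb ->]]] := divclassP g; have r1 := @GRing.lreg1 A.
rewrite divgrp_oppE // divgrp_addE // /divgrp_zero.
apply/divclass_eq => //; do ?exact: GRing.lregM.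
by exists 1; split; [exact: is_unit1 | rewrite mulr1 !mul1r mulrC].
Qed.

HB.instance Definition _ :=
  GRing.isZmodule.Build divgrp divgrp_addA divgrp_addC divgrp_add0 divgrp_addN.

Lemma divclass11 : divclass 1 1 = 0. Proof. by []. Qed.

Lemma divclassD a b c d : GRing.lreg a -> GRing.lreg b -> GRing.lreg c ->
  GRing.lreg d -> divclass a b + divclass c d = divclass (a * c) (b * d).
Proof. exact: divgrp_addE. Qed.

Lemma divclassN a b : GRing.lreg a -> GRing.lreg b -> - divclass a b = divclass b a.
Proof. exact: divgrp_oppE. Qed.

Lemma divclassMn a b n : GRing.lreg a -> GRing.lreg b ->
  divclass a b *+ n = divclass (a ^+ n) (b ^+ n).
Proof.
move=> ra rb; elim: n => [|n IH]; first by rewrite mulr0n.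
by rewrite mulrS IH divclassD -?exprS //; exact: GRing.lregX.
Qed.

Definition effective (g : divgrp) := exists a, GRing.lreg a /\ g = divclass a 1.

Lemma effective_divclass a b : GRing.lreg a -> GRing.lreg b ->
  effective (divclass a b) <-> exists h, a = h * b.
Proof.
have r1 := @GRing.lreg1 A; move=> ra rb; split=> [[h [rh]]|[h e]].
  by move=> /divclass_eq [] // u [uu]; rewrite mulr1 mulrA => e; exists (u * h).
have rh : GRing.lreg h by apply: (@lregMr _ b); rewrite -e.
exists h; split=> //; apply/divclass_eq => //; exists 1.
by split; [exact: is_unit1 | rewrite mulr1 mul1r].
Qed.

Lemma divclass_eq0 a b : GRing.lreg a -> GRing.lreg b ->
  divclass a b = 0 <-> exists h, is_unit h /\ a = h * b.
Proof.
have r1 := @GRing.lreg1 A; move=> ra rb; rewrite -divclass11 divclass_eq //.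
by split=> -[h [uh e]]; exists h; split=> //; move: e; rewrite mulr1 mul1r.
Qed.

Lemma effective0 : effective 0.
Proof. by exists 1; split; [exact: GRing.lreg1 | rewrite divclass11]. Qed.

Lemma effectiveD g h : effective g -> effective h -> effective (g + h).
Proof.
move=> [a [ra ->]] [b [rb ->]]; exists (a * b); split; first exact: GRing.lregM.
by rewrite divclassD ?mulr1 //; exact: GRing.lreg1.
Qed.

Lemma effectiveMn g n : effective g -> effective (g *+ n).
Proof.
move=> eg; elim: n => [|n IH]; first exact: effective0.
by rewrite mulrS; exact: effectiveD.
Qed.

Lemma effective_anti g : effective g -> effective (- g) -> g = 0.
Proof.
have r1 := @GRing.lreg1 A.
move=> [a [ra ->]] [b [rb]]; rewrite divclassN // => /divclass_eq [] // u [uu].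
rewrite mulr1 => e; apply/divclass_eq0 => //; exists a; rewrite mulr1; split=> //.
by exists (u * b); rewrite e; ring.
Qed.

End DivisorGroup.

(** * Partial pullback of divisor classes along a multiplicative map *)

Section Pullback.
Variables (A B : comPzRingType) (phi : A -> B).
Hypothesis phiM : monoid_morphism phi.
Implicit Types (g : divgrp A) (h : divgrp B).

(** A relation and not a map: [phi] may send nonzerodivisors to zerodivisors, so only classes with a
    representative that stays regular have a pullback. *)
Definition divgrp_pullback g h := exists a b,
  [/\ GRing.lreg a, GRing.lreg b, GRing.lreg (phi a), GRing.lreg (phi b)
    & g = divclass a b /\ h = divclass (phi a) (phi b)].

Lemma is_unit_monoid_morphism a : is_unit a -> is_unit (phi a).
Proof. by move=> [b ab]; exists (phi b); rewrite -phiM.2 ab phiM.1. Qed.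

Lemma divgrp_pullbackD g1 g2 h1 h2 : divgrp_pullback g1 h1 ->
  divgrp_pullback g2 h2 -> divgrp_pullback (g1 + g2) (h1 + h2).
Proof.
move=> [a [b [ra rb pa pb [-> ->]]]] [c [d [rc rd pc pd [-> ->]]]].
exists (a * c), (b * d); rewrite !phiM.2 !divclassD //.
by split=> //; exact: GRing.lregM.
Qed.

Lemma divgrp_pullback0 : divgrp_pullback 0 0.
Proof.
have r1 := @GRing.lreg1; exists 1, 1.
by split; rewrite ?phiM.1.
Qed.

Lemma divgrp_pullbackMn g h n :
  divgrp_pullback g h -> divgrp_pullback (g *+ n) (h *+ n).
Proof.
move=> pgh; elim: n => [|n IH]; first exact: divgrp_pullback0.
by rewrite !mulrS; exact: divgrp_pullbackD.
Qed.

Lemma divgrp_pullback_inj g h h' :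
  divgrp_pullback g h -> divgrp_pullback g h' -> h = h'.
Proof.
move=> [a [b [ra rb pa pb [-> ->]]]] [c [d [rc rd pc pd [e ->]]]].
move/divclass_eq: e => [] // u [uu e]; apply/divclass_eq => //; exists (phi u).
by rewrite -!phiM.2 e; split=> //; exact: is_unit_monoid_morphism.
Qed.

(** If [c / d] is the representative that stays regular, then [a * d = u * c], so [phi a] divides
    the nonzerodivisor [phi u * phi c]. Hence for an effective class the pullback can be tested on
    any equation without denominator. *)
Lemma lreg_pullback a h : GRing.lreg a -> divgrp_pullback (divclass a 1) h ->
  GRing.lreg (phi a) /\ h = divclass (phi a) 1.
Proof.
have r1 := @GRing.lreg1; move=> ra [c [d [rc rd pc pd [/divclass_eq []// u [uu]]]]].
rewrite mulr1 => e ->.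
have fu := is_unit_monoid_morphism uu.
have e' : phi a * phi d = phi u * phi c by rewrite -!phiM.2 e.
have pa : GRing.lreg (phi a).
  by apply: (@lregMr _ _ (phi d)); rewrite e'; apply: GRing.lregM => //;
    exact: is_unit_lreg.
split=> //; apply/divclass_eq => //; have [v uv] := fu; exists v.
split; first exact: is_unitV uv.
by rewrite mulr1 e' mulrA [v * _]mulrC uv mul1r.
Qed.

Lemma effective_pullback g h : effective g -> divgrp_pullback g h -> effective h.
Proof. by move=> [a [ra ->]] /(lreg_pullback ra) [pa ->]; exists (phi a). Qed.

(** [phi a] divides [phi (a * b)], which is regular. Effectivity excludes a cancellation between the
    two summands. *)
Lemma divgrp_pullback_summand g1 g2 h : effective g1 -> effective g2 ->
  divgrp_pullback (g1 + g2) h -> exists h1, divgrp_pullback g1 h1.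
Proof.
have r1 := @GRing.lreg1; move=> [a [ra ->]] [b [rb ->]].
rewrite divclassD // mulr1 => /(lreg_pullback (GRing.lregM ra rb)) [].
rewrite phiM.2 => /lregMr pa _; exists (divclass (phi a) 1), a, 1.
by rewrite phiM.1; split.
Qed.

End Pullback.

(** * Stalks *)

Section Stalk.
Variables (k : fieldType) (X : kscheme k) (x : X).
Implicit Types U V W : set X.

Lemma osrD U V (a b : osh X U) : open U -> open V -> V `<=` U ->
  osr U V (a + b) = osr U V a + osr U V b.
Proof.
move=> oU oV VU; have [fB _] := osr_morph oU oV VU.
have f0 : osr U V 0 = 0 by rewrite -(subrr 0) fB subrr.
by rewrite -[b in LHS]opprK fB -[- b]sub0r fB f0 sub0r opprK.
Qed.

Lemma osr0 U V : open U -> open V -> V `<=` U -> osr U V (0 : osh X U) = 0.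
Proof.
move=> oU oV VU; apply: (addrI (osr U V (0 : osh X U))).
by rewrite addr0 -osrD // addr0.
Qed.

Lemma osr_id U (a : osh X U) : open U -> osr U U a = a.
Proof. by case: (kpre_scheme X) => -[_ + _ _ _] _ _; exact. Qed.

(** Stalks turn relations between divisors, which are stated on overlaps of charts, into identities
    in the abelian groups [divgrp (stalk x)]. *)
Record local_section := LocalSection {
  ls_dom : set X;
  ls_open : open ls_dom;
  ls_mem : ls_dom x;
  ls_val : osh X ls_dom }.
HB.instance Definition _ := gen_eqMixin local_section.
HB.instance Definition _ := gen_choiceMixin local_section.

Definition same_germ (s t : local_section) := `[< exists W, [/\ open W, W x,
  W `<=` ls_dom s, W `<=` ls_dom t
  & osr (ls_dom s) W (ls_val s) = osr (ls_dom t) W (ls_val t)] >].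

Lemma same_germ_refl : reflexive same_germ.
Proof.
move=> s; apply/asboolP; exists (ls_dom s).
by split=> //; [exact: ls_open | exact: ls_mem].
Qed.

Lemma same_germ_sym : symmetric same_germ.
Proof.
suff h s t : same_germ s t -> same_germ t s by move=> s t; apply/idP/idP; exact: h.
by move=> /asboolP [W [oW Wx Ws Wt e]]; apply/asboolP; exists W; split.
Qed.

Lemma same_germ_trans : transitive same_germ.
Proof.
move=> t s r /asboolP [W [oW Wx Ws Wt e]] /asboolP [W' [oW' W'x W't W'r e']].
have oI := openI oW oW'; apply/asboolP; exists (W `&` W'); split=> //.
- by move=> z [/Ws].
- by move=> z [_ /W'r].
have := congr1 (osr W (W `&` W')) e; have := congr1 (osr W' (W `&` W')) e'.
have [os ot or] := And3 (@ls_open s) (@ls_open t) (@ls_open r).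
by rewrite !osr_comp // => -> ->.
Qed.

Canonical same_germ_equiv :=
  EquivRel same_germ same_germ_refl same_germ_sym same_germ_trans.

Definition stalk := {eq_quot same_germ}.
HB.instance Definition _ : EqQuotient _ same_germ stalk := EqQuotient.on stalk.
HB.instance Definition _ := Choice.on stalk.

Definition stalk_zero : stalk :=
  \pi_stalk (@LocalSection setT openT Logic.I 0).

(* junk outside the open neighbourhoods of x *)
Definition germ U (s : osh X U) : stalk :=
  match pselect (open U), pselect (U x) with
  | left oU, left Ux => \pi_stalk (LocalSection oU Ux s)
  | _, _ => stalk_zero
  end.

Lemma germE U (s : osh X U) (oU : open U) (Ux : U x) :
  germ s = \pi_stalk (LocalSection oU Ux s).
Proof.
rewrite /germ; case: pselect => // oU'; case: pselect => // Ux'.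
by rewrite (Prop_irrelevance oU' oU) (Prop_irrelevance Ux' Ux).
Qed.

Lemma germ_val (s : local_section) : germ (ls_val s) = \pi_stalk s.
Proof. by rewrite (germE _ (ls_open s) (ls_mem s)); case: s. Qed.

Lemma germ_eq U V (s : osh X U) (t : osh X V) : open U -> U x -> open V -> V x ->
  germ s = germ t <-> exists W, [/\ open W, W x, W `<=` U, W `<=` V
    & osr U W s = osr V W t].
Proof.
move=> oU Ux oV Vx; rewrite (germE s oU Ux) (germE t oV Vx).
by split=> [/eqmodP/asboolP|?] //; apply/eqmodP/asboolP.
Qed.

Lemma germ_res U V (s : osh X U) : open U -> open V -> V x -> V `<=` U ->
  germ (osr U V s) = germ s.
Proof.
move=> oU oV Vx VU; apply/germ_eq => //; first exact: VU.
by exists V; split=> //; rewrite osr_comp.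
Qed.

Lemma germP (a : stalk) : exists U (s : osh X U), [/\ open U, U x & a = germ s].
Proof.
elim/quotW: a => s; exists (ls_dom s), (ls_val s).
by split; [exact: ls_open | exact: ls_mem | rewrite germ_val].
Qed.

Lemma germP2 (a b : stalk) : exists U (s t : osh X U),
  [/\ open U, U x, a = germ s & b = germ t].
Proof.
have [U [s [oU Ux ->]]] := germP a; have [V [t [oV Vx ->]]] := germP b.
have oI := openI oU oV; exists (U `&` V), (osr U _ s), (osr V _ t).
by split=> //; rewrite germ_res.
Qed.

Lemma germP3 (a b c : stalk) : exists U (s t r : osh X U),
  [/\ open U, U x, a = germ s, b = germ t & c = germ r].
Proof.
have [U [s [t [oU Ux -> ->]]]] := germP2 a b.
have [V [r [oV Vx ->]]] := germP c.
have oI := openI oU oV; exists (U `&` V), (osr U _ s), (osr U _ t), (osr V _ r).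
by split=> //; rewrite germ_res.
Qed.

Section Op.
Variable op : forall U, osh X U -> osh X U -> osh X U.
Hypothesis opr : forall U V (s t : osh X U), open U -> open V -> V `<=` U ->
  osr U V (op s t) = op (osr U V s) (osr U V t).

Definition stalk_op2 (a b : stalk) : stalk :=
  let W := ls_dom (repr a) `&` ls_dom (repr b) in
  germ (op (osr _ W (ls_val (repr a))) (osr _ W (ls_val (repr b)))).

Lemma stalk_op2E U (s t : osh X U) : open U -> U x ->
  stalk_op2 (germ s) (germ t) = germ (op s t).
Proof.
move=> oU Ux; rewrite /stalk_op2.
have : germ s = germ (ls_val (repr (germ s))) by rewrite germ_val reprK.
have : germ t = germ (ls_val (repr (germ t))) by rewrite germ_val reprK.
move: (repr _) => t' et; move: (repr _) => s' es.
have [os ms] := conj (@ls_open s') (@ls_mem s').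
have [ot mt] := conj (@ls_open t') (@ls_mem t').
have oI := openI os ot.
move/germ_eq: et => [] // V [oV Vx VU Vt et].
move/germ_eq: es => [] // W [oW Wx WU Ws es].
have oVW := openI oV oW; apply/germ_eq => //; exists (V `&` W); split=> //.
- by move=> z [/Vt ? /Ws].
- by move=> z [/VU].
have := congr1 (osr V (V `&` W)) et; have := congr1 (osr W (V `&` W)) es.
rewrite !osr_comp // => {}es {}et.
have h1 : V `&` W `<=` ls_dom s' `&` ls_dom t' by move=> z [/Vt ? /Ws].
have h2 : V `&` W `<=` U by move=> z [/VU].
by rewrite !opr // !osr_comp // es et.
Qed.
End Op.

Definition stalk_add := stalk_op2 (fun U => +%R).
Definition stalk_mul := stalk_op2 (fun U => *%R).
Definition stalk_one : stalk := germ (1 : osh X setT).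
Definition stalk_opp (a : stalk) : stalk := stalk_mul (germ (-1 : osh X setT)) a.

Lemma germ_add U (s t : osh X U) : open U -> U x ->
  stalk_add (germ s) (germ t) = germ (s + t).
Proof. by apply: stalk_op2E => *; rewrite osrD. Qed.

Lemma germ_mul U (s t : osh X U) : open U -> U x ->
  stalk_mul (germ s) (germ t) = germ (s * t).
Proof. by apply: stalk_op2E => *; rewrite osrM. Qed.

Lemma germ_zero U : open U -> U x -> germ (0 : osh X U) = stalk_zero.
Proof.
move=> oU Ux; have oT := @openT X; rewrite /stalk_zero -germE.
by rewrite -(germ_res 0 oT oU) // osr0.
Qed.

Lemma germ_one U : open U -> U x -> germ (1 : osh X U) = stalk_one.
Proof.
move=> oU Ux; have oT := @openT X; rewrite /stalk_one.
by rewrite -(germ_res 1 oT oU) // osr1.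
Qed.

Lemma germ_opp U (s : osh X U) : open U -> U x -> stalk_opp (germ s) = germ (- s).
Proof.
move=> oU Ux; have oT := @openT X; rewrite /stalk_opp -(germ_res (-1) oT oU) //.
rewrite germ_mul // -[-1]sub0r.
by have [-> _] := osr_morph oT oU (@subsetT _ U); rewrite osr0 // osr1 // sub0r mulN1r.
Qed.

Lemma stalk_addA : associative stalk_add.
Proof.
move=> a b c; have [U [s [t [r [oU Ux -> -> ->]]]]] := germP3 a b c.
by rewrite !germ_add // addrA.
Qed.

Lemma stalk_addC : commutative stalk_add.
Proof.
move=> a b; have [U [s [t [oU Ux -> ->]]]] := germP2 a b.
by rewrite !germ_add // addrC.
Qed.

Lemma stalk_add0 : left_id stalk_zero stalk_add.
Proof.
move=> a; have [U [s [oU Ux ->]]] := germP a.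
by rewrite -(germ_zero oU Ux) germ_add // add0r.
Qed.

Lemma stalk_addN : left_inverse stalk_zero stalk_opp stalk_add.
Proof.
move=> a; have [U [s [oU Ux ->]]] := germP a.
by rewrite germ_opp // germ_add // addNr germ_zero.
Qed.

HB.instance Definition _ :=
  GRing.isZmodule.Build stalk stalk_addA stalk_addC stalk_add0 stalk_addN.

Lemma stalk_mulA : associative stalk_mul.
Proof.
move=> a b c; have [U [s [t [r [oU Ux -> -> ->]]]]] := germP3 a b c.
by rewrite !germ_mul // mulrA.
Qed.

Lemma stalk_mulC : commutative stalk_mul.
Proof.
move=> a b; have [U [s [t [oU Ux -> ->]]]] := germP2 a b.
by rewrite !germ_mul // mulrC.
Qed.

Lemma stalk_mul1 : left_id stalk_one stalk_mul.
Proof.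
move=> a; have [U [s [oU Ux ->]]] := germP a.
by rewrite -(germ_one oU Ux) germ_mul // mul1r.
Qed.

Lemma stalk_mulDl : left_distributive stalk_mul +%R.
Proof.
move=> a b c; have [U [s [t [r [oU Ux -> -> ->]]]]] := germP3 a b c.
by rewrite /+%R /= germ_add // !germ_mul // germ_add // mulrDl.
Qed.

HB.instance Definition _ := GRing.Zmodule_isComPzRing.Build stalk
  stalk_mulA stalk_mulC stalk_mul1 stalk_mulDl.

Lemma germM U (s t : osh X U) : open U -> U x -> germ (s * t) = germ s * germ t.
Proof. by move=> oU Ux; rewrite -germ_mul. Qed.

Lemma germ1 U : open U -> U x -> germ (1 : osh X U) = 1.
Proof. exact: germ_one. Qed.

Lemma germ0 U : open U -> U x -> germ (0 : osh X U) = 0.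
Proof. exact: germ_zero. Qed.

Lemma germX U (s : osh X U) n : open U -> U x -> germ (s ^+ n) = germ s ^+ n.
Proof.
move=> oU Ux; elim: n => [|n IH]; first by rewrite !expr0 germ1.
by rewrite !exprS germM // IH.
Qed.

Lemma is_unit_germ U (s : osh X U) : open U -> U x ->
  is_unit s -> is_unit (germ s).
Proof. by move=> oU Ux [t st]; exists (germ t); rewrite -germM // st germ1. Qed.

Lemma is_unit_germP (u : stalk) : is_unit u ->
  exists V (v : osh X V), [/\ open V, V x, is_unit v & u = germ v].
Proof.
move=> [v]; have [U [s [t [oU Ux -> ->]]]] := germP2 u v.
rewrite -germM // -(germ1 oU Ux) => /germ_eq [] // W [oW Wx WU _].
rewrite osrM // osr1 // => e; exists W, (osr U W s).
by split=> //; [exists (osr U W t) | rewrite germ_res].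
Qed.

Lemma regular_germ U (s : osh X U) : open U -> U x -> regular_section s ->
  GRing.lreg (germ s).
Proof.
move=> oU Ux rs; apply: GRing.mulrI0_lreg => b; have [V [t [oV Vx ->]]] := germP b.
have oI := openI oU oV; set W := U `&` V in oI.
have WU : W `<=` U by move=> z [].
have WV : W `<=` V by move=> z [].
have Wx : W x by [].
rewrite -(germ_res s oU oI) // -(germ_res t oV oI) // -germM // -(germ0 oI Wx).
move=> /germ_eq [] // O [oO Ox OW _]; rewrite osrM // osr0 // osr_comp //.
move=> /(rs O _ oO (subset_trans OW WU)) e.
by apply/germ_eq => //; exists O; split=> //; rewrite e osr0.
Qed.

End Stalk.
Arguments germ {k X} x {U} s.

Section Germs.
Variables (k : fieldType) (X : kscheme k).
Implicit Types U V W : set X.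

Lemma section_eq0 U (a : osh X U) : open U ->
  (forall x, U x -> germ x a = 0) -> a = 0.
Proof.
move=> oU h; have [[_ _ _ sep _] _ _] := kpre_scheme X.
pose C := [set V : set X | [/\ open V, V `<=` U & osr U V a = 0]].
apply: (sep U C) => //; [by move=> V []| |by move=> V []].
move=> x Ux; have := h x Ux; rewrite -(germ0 oU Ux) => /germ_eq [] // W [oW Wx WU _ e].
by exists W => //; split=> //; rewrite e osr0.
Qed.

Lemma regular_sectionP U (s : osh X U) : open U ->
  (forall x, U x -> GRing.lreg (germ x s)) -> regular_section s.
Proof.
move=> oU h V a oV VU e; apply: section_eq0 => // x Vx.
apply: (h x (VU _ Vx)); rewrite mulr0 -(germ_res s oU oV) // -germM // e germ0 //.
Qed.

End Germs.

(** * Cartier divisors at a point *)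

Section DivisorsAt.
Variables (k : fieldType) (X : kscheme k).
Implicit Types (U V W : set X) (D E : cdiv X).

Definition cd_at D x : divgrp (stalk x) :=
  divclass (germ x (cnum D x)) (germ x (cden D x)).

Lemma lreg_cnum D x y : cdom D y x -> GRing.lreg (germ x (cnum D y)).
Proof.
move=> Dx; exact: regular_germ (cdom_open D y) Dx (@cnum_reg _ _ D y).
Qed.

Lemma lreg_cden D x y : cdom D y x -> GRing.lreg (germ x (cden D y)).
Proof.
move=> Dx; exact: regular_germ (cdom_open D y) Dx (@cden_reg _ _ D y).
Qed.

(** A unit of the stalk and an equality of germs both spread to a neighbourhood, so comparing
    fractions point by point loses nothing. *)
Lemma local_eqP D V (a b : osh X V) : local_eq D a b <->
  [/\ open V, regular_section a, regular_section b
    & forall x, V x -> cd_at D x = divclass (germ x a) (germ x b)].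
Proof.
have oD := cdom_open D.
split=> -[oV ra rb h]; split=> // x Vx.
  have [W [u [oW Wx WV uu e]]] := h x Vx.
  have Dx := cdom_mem D x.
  have WV' : W `<=` V by move=> z /WV [].
  have WD : W `<=` cdom D x by move=> z /WV [].
  apply/esym/divclass_eq; do ?[exact: regular_germ | exact: lreg_cnum | exact: lreg_cden].
  exists (germ x u); split; first exact: is_unit_germ.
  have := congr1 (germ x) e.
  by rewrite !germM // !germ_res.
have Dx := cdom_mem D x.
move/esym/divclass_eq: (h x Vx) => [];
  do ?[exact: regular_germ | exact: lreg_cnum | exact: lreg_cden].
move=> _ [/is_unit_germP [U [u [oU Ux uu ->]]]].
have oI := openI (openI oU oV) (oD x); set I := _ `&` _ in oI.
have Ix : I x by [].
have IU : I `<=` U by move=> z [] [].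
have IV : I `<=` V by move=> z [] [].
have ID : I `<=` cdom D x by move=> z [].
rewrite -(germ_res a oV oI) // -(germ_res b oV oI) // -(germ_res u oU oI) //.
rewrite -(germ_res (cnum D x) _ oI) // -(germ_res (cden D x) _ oI) //.
rewrite -!germM // => /germ_eq [] // W [oW Wx WI _].
have WU : W `<=` U by exact: subset_trans WI IU.
have WV : W `<=` V by exact: subset_trans WI IV.
have WD : W `<=` cdom D x by exact: subset_trans WI ID.
rewrite !osrM // !osr_comp // => e; exists W, (osr U W u); split=> //.
- by move=> z Wz; split; [exact: WV | exact: WD].
- exact: is_unit_res.
Qed.

Lemma cd_at_cdom D x y : cdom D y x ->
  cd_at D x = divclass (germ x (cnum D y)) (germ x (cden D y)).
Proof. by move=> Dyx; have /local_eqP [_ _ _ ->] := local_eq_self D y. Qed.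

Lemma cd_eqP D E : cd_eq D E <-> forall x, cd_at D x = cd_at E x.
Proof.
split=> [h x|h x].
  have [V [a [b [Vx /local_eqP [_ _ _ ->] // /local_eqP [_ _ _ ->] //]]]] := h x.
exists (cdom D x), (cnum D x), (cden D x); have Dx := cdom_mem D x.
split=> //; first exact: local_eq_self.
apply/local_eqP; split; [exact: cdom_open|exact: cnum_reg|exact: cden_reg|].
by move=> y Dxy; rewrite -h (cd_at_cdom Dxy).
Qed.

Lemma cd_at_add D E x : cd_at (cd_add D E) x = cd_at D x + cd_at E x.
Proof.
have [Dx Ex] := (cdom_mem D x, cdom_mem E x).
have [oD oE] := (cdom_open D x, cdom_open E x); have oI := openI oD oE.
rewrite /cd_at /= !germM // !germ_res // divclassD //;
  do ?[exact: lreg_cnum | exact: lreg_cden].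
Qed.

Lemma cd_at_opp D x : cd_at (cd_opp D) x = - cd_at D x.
Proof.
have Dx := cdom_mem D x.
by rewrite /cd_at divclassN //; [exact: lreg_cnum | exact: lreg_cden].
Qed.

Lemma cd_at_muln n D x : cd_at (cd_muln n D) x = cd_at D x *+ n.
Proof.
have Dx := cdom_mem D x; have oD := cdom_open D x.
by rewrite /cd_at /= !germX // divclassMn //; [exact: lreg_cnum | exact: lreg_cden].
Qed.

(** Common core of the germ criteria for effectivity ([Q'] always true) and for the support ([Q'] is
    [is_unit]). *)
Lemma frac_factorP D x (Q : stalk x -> Prop)
    (Q' : forall V, osh X V -> Prop) :
  (forall h, Q h <-> exists V (s : osh X V), [/\ open V, V x, Q' V s & h = germ x s]) ->
  (forall U V (s : osh X U), open U -> open V -> V `<=` U -> Q' U s ->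
    Q' V (osr U V s)) ->
  (exists h, Q h /\ germ x (cnum D x) = h * germ x (cden D x)) <->
  exists V (h : osh X V), [/\ open V, V x, V `<=` cdom D x, Q' V h
    & osr (cdom D x) V (cnum D x) = h * osr (cdom D x) V (cden D x)].
Proof.
move=> QP resQ'; have Dx := cdom_mem D x; have oD := cdom_open D x.
split=> [[_ [/QP [U [h [oU Ux qh ->]]]]]|[V [h [oV Vx VD qh /(congr1 (germ x))]]]].
  have oI := openI oU oD; set I := _ `&` _ in oI.
  have IU : I `<=` U by move=> z [].
  have ID : I `<=` cdom D x by move=> z [].
  rewrite -(germ_res h oU oI) // -!(germ_res _ oD oI) // -germM //.
  move=> /germ_eq [] // W [oW Wx WI _].
  have WU : W `<=` U by exact: subset_trans WI IU.
  have WD : W `<=` cdom D x by exact: subset_trans WI ID.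
  rewrite osrM // !osr_comp // => e; exists W, (osr U W h).
  by split=> //; exact: resQ' qh.
rewrite germM // !germ_res // => e; exists (germ x h); split=> //.
by apply/QP; exists V, h.
Qed.

Lemma cd_effectiveP D : cd_effective D <-> forall x, effective (cd_at D x).
Proof.
have P x : effective (cd_at D x) <-> exists V (h : osh X V),
  [/\ open V, V x, V `<=` cdom D x, True
    & osr (cdom D x) V (cnum D x) = h * osr (cdom D x) V (cden D x)].
  have Dx := cdom_mem D x.
  apply: iff_trans (frac_factorP D (x := x) (Q := fun=> True) _ _) => //; last first.
    by move=> h; split=> // _; have [V [s [oV Vx ->]]] := germP h; exists V, s.
  apply: iff_trans (effective_divclass (lreg_cnum Dx) (lreg_cden Dx)) _.
  by split=> -[h] => [e|[_ e]]; exists h.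
split=> h x.
  by apply/P; have [V [s [? ? ? ?]]] := h x; exists V, s.
by have /P [V [s [? ? ? _ ?]]] := h x; exists V, s.
Qed.

Lemma cd_supportP D x : cd_support D x <-> cd_at D x <> 0.
Proof.
have Dx := cdom_mem D x.
suff P : cd_at D x = 0 <-> exists V (h : osh X V),
  [/\ open V, V x, V `<=` cdom D x, is_unit h
    & osr (cdom D x) V (cnum D x) = h * osr (cdom D x) V (cden D x)].
  by split=> h e; apply: h; apply/P.
apply: iff_trans (divclass_eq0 (lreg_cnum Dx) (lreg_cden Dx)) _.
apply: frac_factorP => [h|]; last exact: is_unit_res.
split=> [/is_unit_germP //|[V [s [oV Vx us ->]]]]; exact: is_unit_germ.
Qed.

(** [h] is regular since it divides the regular numerator of [D]. Equations with denominator 1 are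
    those that [lreg_pullback] controls. *)
Lemma effective_local_eq D x : cd_effective D -> exists V (h : osh X V),
  [/\ V x, V `<=` cdom D x, local_eq D h 1
    & osr (cdom D x) V (cnum D x) = h * osr (cdom D x) V (cden D x)].
Proof.
move=> eff; have oD := cdom_open D x.
have [V [h [oV Vx VD e]]] := eff x; exists V, h; split=> //.
apply/local_eqP; have rh : regular_section h.
  apply: regular_sectionP => // y Vy; have Dy := VD y Vy.
  apply: (@lregMr _ _ (germ y (cden D x))).
  have := congr1 (germ y) e; rewrite germM // !germ_res // => <-.
  exact: lreg_cnum.
split=> //; first exact: regular1.
move=> y Vy; have Dy := VD y Vy; rewrite (cd_at_cdom Dy) germ1 //.
apply/divclass_eq; do ?[exact: lreg_cnum | exact: lreg_cden | exact: regular_germ].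
  exact: GRing.lreg1.
exists 1; split; first exact: is_unit1.
by have := congr1 (germ y) e; rewrite germM // !germ_res // mulr1 mul1r.
Qed.

End DivisorsAt.

(** * Pullbacks of Cartier divisors *)

Section StalkMap.
Variables (k : fieldType) (Y X : kscheme k) (f : mor Y X).
Implicit Types (U V W : set X) (D : cdiv X) (E : cdiv Y).

Lemma msh1 U : open U -> msh f U 1 = 1.
Proof. by move=> oU; have [_ [-> _]] := msh_morph f oU. Qed.

Lemma mshM U (a b : osh X U) : open U -> msh f U (a * b) = msh f U a * msh f U b.
Proof. by move=> oU; have [_ [_ ->]] := msh_morph f oU. Qed.

Definition stalk_map y (a : stalk (f y)) : stalk y :=
  germ y (msh f (ls_dom (repr a)) (ls_val (repr a))).

Lemma stalk_map_germ y V (s : osh X V) : open V -> V (f y) ->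
  stalk_map (germ (f y) s) = germ y (msh f V s).
Proof.
move=> oV Vfy; rewrite /stalk_map.
have : germ (f y) s = germ (f y) (ls_val (repr (germ (f y) s))).
  by rewrite germ_val reprK.
move: (repr _) => t; have [oT Tx] := conj (ls_open t) (ls_mem t).
move=> /germ_eq [] // W [oW Wx WV WT /(congr1 (fun s => germ y (msh f W s)))].
have oF U : open U -> open (f @^-1` U) by exact: mfun_cont.
by rewrite !msh_res // !germ_res //; do ?[exact: oF | by move=> z /WV | by move=> z /WT].
Qed.

Lemma stalk_map_morphism y : monoid_morphism (@stalk_map y).
Proof.
have oT := @openT X; split.
  have oF := mfun_cont f oT; rewrite -(germ1 (x := f y) oT Logic.I).
  by rewrite stalk_map_germ // msh1 // (germ1 oF).
move=> a b; have [U [s [t [oU Ux -> ->]]]] := germP2 a b.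
rewrite -germM // !stalk_map_germ // mshM // germM //; exact: mfun_cont.
Qed.

Definition pullback_at y := divgrp_pullback (@stalk_map y).

Lemma cd_is_pullback_at D E y : cd_is_pullback f D E ->
  pullback_at (cd_at D (f y)) (cd_at E y).
Proof.
move=> h; have [V [a [b [Vfy /local_eqP [oV ra rb e]
  /local_eqP [oV' ra' rb' e']]]]] := h y.
exists (germ (f y) a), (germ (f y) b); rewrite !stalk_map_germ //.
by split; do ?[exact: regular_germ | rewrite e // e'].
Qed.

Lemma regular_pullback D V (h : osh X V) : local_eq D h 1 ->
  (forall y, exists g, pullback_at (cd_at D (f y)) g) ->
  regular_section (msh f V h).
Proof.
move=> /local_eqP [oV rh _ e] pD; apply: regular_sectionP => [|y Vy].
  exact: mfun_cont.
have [g] := pD y; rewrite e // germ1 // => /(lreg_pullback (stalk_map_morphism y)) [].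
  exact: regular_germ.
by rewrite stalk_map_germ.
Qed.

(** A priori each point of [Y] has its own fraction that pulls back well. Effectivity gives one
    equation [h / 1] near [f y], and by [lreg_pullback] it works at all points over its domain. *)
Lemma cd_is_pullbackI D E : cd_effective D ->
  (forall y, pullback_at (cd_at D (f y)) (cd_at E y)) -> cd_is_pullback f D E.
Proof.
move=> eD pDE y; have [V [h [Vfy _ Dh _]]] := effective_local_eq (f y) eD.
have [oV rh _ e] := (local_eqP _ _ _).1 Dh.
have oF := mfun_cont f oV.
exists V, h, 1; split=> //; apply/local_eqP; rewrite msh1 //.
split=> //; first by apply: regular_pullback Dh _ => z; exists (cd_at E z).
  exact: regular1.
move=> z Vz; have := pDE z.
rewrite e // germ1 // => /(lreg_pullback (stalk_map_morphism z)) [].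
  exact: regular_germ.
by rewrite stalk_map_germ // germ1.
Qed.

Lemma cd_pullback_effective D E : cd_effective D -> cd_is_pullback f D E ->
  cd_effective E.
Proof.
move=> /cd_effectiveP eD pDE; apply/cd_effectiveP => y.
apply: (effective_pullback (stalk_map_morphism y) (eD (f y))).
exact: cd_is_pullback_at.
Qed.

(** Equations [h x / 1] are chosen near all points of [X] and pulled back, together with the units
    that relate them on overlaps. *)
Lemma cd_pullback_ex D : cd_effective D ->
  (forall y, exists g, pullback_at (cd_at D (f y)) g) ->
  exists E, cd_is_pullback f D E.
Proof.
move=> eD pD.
have /choice [eqn eqnP] : forall x, exists p : {V : set X & osh X V},
    [/\ projT1 p x, projT1 p `<=` cdom D x, local_eq D (projT2 p) 1
      & osr (cdom D x) (projT1 p) (cnum D x)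
        = projT2 p * osr (cdom D x) (projT1 p) (cden D x)].
  by move=> x; have [V [h H]] := effective_local_eq x eD; exists (existT _ V h).
pose V x := projT1 (eqn x); pose h x : osh X (V x) := projT2 (eqn x).
have Vx x : V x x by have [] := eqnP x.
have VD x : V x `<=` cdom D x by have [] := eqnP x.
have Dh x : local_eq D (h x) 1 by have [] := eqnP x.
have oV x : open (V x) by have [] := Dh x.
have oD := cdom_open D.
have oF x : open (f @^-1` V x) by exact: mfun_cont.
have hE x : osr (cdom D x) (V x) (cnum D x)
    = h x * osr (cdom D x) (V x) (cden D x) by have [] := eqnP x.
have compat x x' : let W := V x `&` V x' in exists u : osh X W,
    is_unit u /\ osr (V x) W (h x) = u * osr (V x') W (h x').
  move=> W; have oW : open W by exact: openI.
  have [u [uu e]] := cdiv_compat D x x'.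
  set W' := cdom D x `&` cdom D x' in u uu e.
  have oW' : open W' by exact: openI.
  have WW' : W `<=` W' by move=> z [/VD ? /VD].
  have W1 : W `<=` V x by move=> z [].
  have W2 : W `<=` V x' by move=> z [].
  have D1 : W `<=` cdom D x by move=> z /W1 /VD.
  have D2 : W `<=` cdom D x' by move=> z /W2 /VD.
  exists (osr W' W u); split; first exact: is_unit_res.
  (* [cdiv_compat] relates fractions; cancelling this product of denominators leaves the same unit
     between the equations [h]. *)
  have rc : regular_section (osr (cdom D x) W (cden D x) * osr (cdom D x') W (cden D x')).
    by apply: regularM => //; apply: regular_res => //; exact: cden_reg.
  apply/subr0_eq/(rc W) => //; rewrite osr_id // mulrBr; apply/eqP; rewrite subr_eq0.
  have := congr1 (osr (V x) W) (hE x); have := congr1 (osr (V x') W) (hE x').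
  have := congr1 (osr W' W) e.
  rewrite !osrM // !osr_comp //; do ?by move=> z [].
  move=> {}e e2 e1; rewrite e1 e2 in e; apply/eqP.
  by rewrite mulrC mulrA e; ring.
pose dom y := f @^-1` V (f y).
have num_reg y : regular_section (msh f (V (f y)) (h (f y))).
  exact: regular_pullback (Dh (f y)) pD.
have comp y y' : let W := dom y `&` dom y' in exists u : osh Y W,
    is_unit u /\ osr (dom y) W (msh f (V (f y)) (h (f y))) * osr (dom y') W 1
    = u * (osr (dom y') W (msh f (V (f y')) (h (f y'))) * osr (dom y) W 1).
  move=> W; have [u [uu e]] := compat (f y) (f y').
  set W0 := V (f y) `&` V (f y') in u uu e.
  have oW0 : open W0 by exact: openI.
  have oW : open W by apply: openI; exact: oF.
  have [od od'] := conj (oF (f y)) (oF (f y')).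
  have W1 : W `<=` dom y by move=> z [].
  have W2 : W `<=` dom y' by move=> z [].
  have W01 : W0 `<=` V (f y) by move=> z [].
  have W02 : W0 `<=` V (f y') by move=> z [].
  exists (msh f W0 u); split.
    exact: is_unit_monoid_morphism (msh_morph f oW0).2 _ uu.
  rewrite (osr1 od oW) // (osr1 od' oW) // !mulr1.
  (* The preimage of [W0] is [W] up to conversion. *)
  have e1 := msh_res f (h (f y)) (oV _) oW0 W01.
  have e2 := msh_res f (h (f y')) (oV _) oW0 W02.
  by rewrite -[RHS](congr1 (fun s => msh f W0 u * s) e2) -[LHS]e1 e mshM.
pose E : cdiv Y := CDiv (fun y => oF (f y)) (fun y => Vx (f y)) num_reg
  (fun y => regular1 (oF (f y))) comp.
exists E; apply: cd_is_pullbackI => // y; have [oy Vy] := conj (oV (f y)) (Vx (f y)).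
have /local_eqP [_ rh _ e] := Dh (f y); have [g pg] := pD y.
rewrite e // germ1 // in pg *; have rg := regular_germ oy Vy rh.
have [pr eg] := lreg_pullback (stalk_map_morphism y) rg pg.
suff -> : cd_at E y = g by [].
rewrite eg /cd_at /E /= germ1 //.
by rewrite stalk_map_germ.
Qed.

End StalkMap.

(** * Effectivity on normal schemes *)

Section RingMorphism.
Variables (A B : comPzRingType) (f : A -> B).
Hypothesis fM : ring_morphism f.

Lemma ring_morphismB a b : f (a - b) = f a - f b.
Proof. by case: fM. Qed.

Lemma ring_morphism0 : f 0 = 0.
Proof. by rewrite -(subrr 0) ring_morphismB subrr. Qed.

Lemma ring_morphismD a b : f (a + b) = f a + f b.
Proof.
by rewrite -[b in LHS]opprK ring_morphismB -[- b]sub0r ring_morphismB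
  ring_morphism0 sub0r opprK.
Qed.

Lemma ring_morphismM a b : f (a * b) = f a * f b.
Proof. by case: fM => _ [_]. Qed.

Lemma ring_morphismX a n : f (a ^+ n) = f a ^+ n.
Proof.
elim: n => [|n IH]; first by rewrite !expr0; case: fM => _ [].
by rewrite !exprS ring_morphismM IH.
Qed.

Lemma ring_morphism_sum n (F : 'I_n -> A) : f (\sum_i F i) = \sum_i f (F i).
Proof. by apply: big_morph; [exact: ring_morphismD | exact: ring_morphism0]. Qed.

End RingMorphism.

Lemma domain_mulI (A : comPzRingType) (a : A) :
  domain A -> a != 0 -> injective ( *%R a).
Proof.
move=> [_ dA] /eqP a0 b c /eqP; rewrite -subr_eq0 -mulrBr => /eqP /dA [] // /eqP.
by rewrite subr_eq0 => /eqP.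
Qed.

Lemma domain_mul_neq0 (A : comPzRingType) (a b : A) :
  domain A -> a != 0 -> b != 0 -> a * b != 0.
Proof.
move=> [_ dA] /eqP a0 /eqP b0; apply/eqP => /dA []; [exact: a0|exact: b0].
Qed.

Lemma domain_exp_neq0 (A : comPzRingType) (a : A) n :
  domain A -> a != 0 -> a ^+ n != 0.
Proof.
move=> dA a0; elim: n => [|n IH]; first by rewrite expr0; case: dA.
by rewrite exprS; exact: domain_mul_neq0.
Qed.

(** [p / q] is a root of [X^(n+1) - h] with [h] integral over [A], so it is integral over [A]. The
    closure property speaks of fractions of [A] only, so [p / q] is first written as one and its
    equation over [A] is made explicit. *)
Lemma integral_closure_root (A B : comPzRingType) (f : A -> B) (p q h : B) n :
  is_integral_closure f -> q != 0 -> p ^+ n.+1 = h * q ^+ n.+1 ->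
  exists g, p = g * q.
Proof.
move=> [[dA dB] fM finj fracB closB] q0 e.
have [f0 fsum] := (ring_morphism0 fM, ring_morphism_sum fM).
have [fmul fexp] := (ring_morphismM fM, ring_morphismX fM).
have f_neq0 a : a != 0 -> f a != 0.
  by apply: contra_neq => fa0; apply: finj; rewrite fa0 f0.
have [_ [a [c [c0 qE]]]] := fracB q.
have [_ [a' [c' [c'0 pE]]]] := fracB p.
have a0 : a != 0.
  apply: contraNneq (domain_mul_neq0 dB (f_neq0 _ c0) q0) => a0.
  by rewrite qE a0 f0.
(* With [q = a / c] and [p = a' / c'], this makes [p / q = x / y]. *)
set x := a' * c; set y := c' * a.
have y0 : y != 0 by exact: domain_mul_neq0.
have fpq : f y * p = f x * q.
  rewrite /x /y !fmul -[RHS]mulrA qE.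
  have -> : f c' * f a * p = (f c' * p) * f a by ring.
  by rewrite pE.
clearbody x y.
have fxn : f x ^+ n.+1 = f y ^+ n.+1 * h.
  apply: (domain_mulI dB (domain_exp_neq0 n.+1 dB q0)).
  by rewrite mulrC -exprMn -fpq exprMn e; ring.
have [[m [c1 hE]] _] := fracB h.
(* Since [h] is the power [n+1] of [x / y], the equation of degree [m] for [h] is one of degree
   [m (n+1)] for [x / y], with zero coefficients off the multiples of [n+1]. [d] extends [c1] by 0
   to all naturals. *)
pose d i := if insub i is Some j then c1 j else 0.
pose c2 (j : 'I_(m * n.+1)) := if (n.+1 %| j)%N then d (j %/ n.+1)%N else 0.
have [|g gE] := closB x y (m * n.+1)%N c2 y0; last first.
  exists g; apply: (domain_mulI dB (f_neq0 _ y0)).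
  by rewrite mulrA gE.
(* The sum is cut into [m] blocks of length [n+1], of which only the first terms survive. *)
rewrite -(big_mkord xpredT (fun j => (if (n.+1 %| j)%N then d (j %/ n.+1)%N else 0) *
   (x ^+ j * y ^+ (m * n.+1 - j)))) big_nat_mul big_mkord.
apply: finj; rewrite fsum // fexp //.
rewrite mulnC exprM fxn exprMn hE mulr_sumr; apply: eq_bigr => i _.
rewrite big_ltn; last by rewrite ltn_mul2r ltnSn.
rewrite dvdn_mull // mulnK // big_nat big1 => [|j /andP[ij ji]].
  rewrite /= addr0 /d valK !fmul !fexp.
  have le : (i * n.+1 <= m * n.+1)%N by rewrite leq_mul2r ltnW ?orbT.
  rewrite -exprM [(n.+1 * m)%N]mulnC -{1}(subnK le) exprD.
  have -> : f x ^+ (i * n.+1) = f y ^+ (i * n.+1) * h ^+ i.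
    by rewrite mulnC !exprM fxn exprMn.
  by ring.
have -> : (n.+1 %| j)%N = false; last by rewrite mul0r.
apply/negP => /dvdnP [l jE]; move: ij ji; rewrite jE ltn_mul2r ltn_mul2r /= ltnS.
by move=> /leq_trans h1 /h1; rewrite ltnn.
Qed.

Section Normality.
Variables (k : fieldType) (V N : kscheme k) (nu : mor N V).

Lemma basic_open_open U (s : osh N U) : open U -> open (basic_open s).
Proof.
move=> oU; rewrite openE => x [Ux [W [oW Wx WU us]]].
rewrite /interior nbhsE; exists W => // y Wy; split; first exact: WU.
by exists W.
Qed.

Lemma section_neq0 (x : N) U (c : osh N U) : open U -> U x ->
  regular_section c -> c != 0.
Proof.
move=> oU Ux rc; apply/eqP => c0; have [_ loc _] := kpre_scheme N.
have [/eqP h _] := loc x U oU Ux; apply: h.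
by apply: (rc U) => //; rewrite c0 mulr1 osr0.
Qed.

(** [cnum / cden] is a root of [X^(n+1) - h]. Integral closedness is available only over affine
    opens of [V], while [h] lives on a smaller neighbourhood; on a basic open set inside both,
    sections are fractions with powers of [s] below. *)
Lemma normal_effective (D : cdiv N) n :
  is_normalization nu -> cd_effective (cd_muln n.+1 D) -> cd_effective D.
Proof.
move=> norm eff x; have [_ _ cov] := kpre_scheme V.
have [U [aU Ux]] := cov (nu x); have U0 : U !=set0 by exists (nu x).
have [aW intW] := norm U aU U0; set W : set N := nu @^-1` U in aW intW.
have Wx : W x by [].
have [oW _ basis locW] := aW; have [[_ dB] _ _ _ _] := intW.
have [O [h [oO Ox OD e]]] := eff x.
have oD := cdom_open D x.
have [s [Sx SO]] := basis (O `&` W) x (openI oO oW) (@subIsetr _ _ _) (conj Ox Wx).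
set S := basic_open s in Sx SO; have oS : open S by exact: basic_open_open.
have SW : S `<=` W by move=> z [].
have SO' : S `<=` O by move=> z /SO [].
have SD : S `<=` cdom D x by move=> z /SO' /OD.
have [fM [v sv] fsur ker] := locW s; rewrite -/S in v sv fM fsur ker.
set f := osr W S in v sv fM fsur ker.
have [fmul fexp] := (ring_morphismM fM, ring_morphismX fM).
have vn m (a b : osh N S) : a * f s ^+ m = b * f s ^+ m -> a = b.
  move=> /(congr1 (fun z => z * v ^+ m)).
  by rewrite -!mulrA -exprMn sv expr1n !mulr1.
have S1 : (1 : osh N S) != 0 by exact: (section_neq0 oS Sx (regular1 oS)).
have s0 : s != 0.
  apply: contraNneq S1 => s0; rewrite -sv s0.
  by rewrite (ring_morphism0 fM) mul0r.
have finj : injective f.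
  move=> a b /eqP; rewrite -subr_eq0 -(ring_morphismB fM) => /eqP /ker [m].
  rewrite -(mulr0 (s ^+ m)) => /(domain_mulI dB (domain_exp_neq0 m dB s0)).
  by move=> /subr0_eq.
set num := osr (cdom D x) S (cnum D x); set den := osr (cdom D x) S (cden D x).
have {}e : num ^+ n.+1 = osr O S h * den ^+ n.+1.
  have := congr1 (osr O S) e.
  by rewrite /= osrM // !osr_comp // !osrX.
have [p [i pE]] := fsur num; have [q [j qE]] := fsur den.
have [t [l tE]] := fsur (osr O S h).
have den0 : den != 0.
  apply: (section_neq0 oS Sx); apply: regular_res => //; exact: cden_reg.
have q0 : q * s ^+ i != 0.
  apply: domain_mul_neq0 (domain_exp_neq0 i dB s0) => //.
  apply: contraNneq den0 => q0; apply/eqP/(vn j).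
  by rewrite qE q0 (ring_morphism0 fM) mul0r.
(* These are [num s^(i+j+l)], [den s^(i+j)] and [h s^(l(n+1))]: the powers of [s] clear all
   denominators and keep the equation homogeneous. *)
have [|g gE] := @integral_closure_root _ _ _ (p * s ^+ j * s ^+ l) (q * s ^+ i)
    (t * s ^+ (l * n)) n intW q0.
  apply: finj; rewrite !fmul !fexp !fmul !fexp -pE -qE -tE.
  rewrite exprM !exprMn e !exprS; ring.
exists S, (f g * v ^+ l); split=> //; rewrite -/num -/den.
apply: (vn (i + j + l)%N).
have := congr1 f gE; rewrite !fmul !fexp -pE -qE => {}gE.
have -> : num * f s ^+ (i + j + l) = num * f s ^+ i * f s ^+ j * f s ^+ l.
  by rewrite !exprD; ring.
rewrite gE !exprD.
have -> : f g * v ^+ l * den * (f s ^+ i * f s ^+ j * f s ^+ l) =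
  f g * (den * f s ^+ j * f s ^+ i) * (f s * v) ^+ l by rewrite exprMn; ring.
by rewrite sv expr1n mulr1.
Qed.

End Normality.

(** * Divisors with rational coefficients *)

Section RationalDivisors.
Variable k : fieldType.
Implicit Types (X Y : kscheme k) (L : coefficient_ring).

(** The common ground on which moduli for the two coefficient rings are compared. *)
Definition ldiv_rat L X : ldiv L X -> qcdiv X :=
  match L with LambdaZ => fun D => (D, 0%N) | LambdaQ => id end.

Lemma qcd_eqP X (D E : qcdiv X) : qcd_eq D E <-> exists N, forall x,
  cd_at D.1 x *+ (N.+1 * E.2.+1) = cd_at E.1 x *+ (N.+1 * D.2.+1).
Proof.
split=> -[N h]; exists N.
  by move=> x; move/cd_eqP/(_ x): h; rewrite !cd_at_muln.
by apply/cd_eqP => x; rewrite !cd_at_muln h.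
Qed.

Lemma qcd_eq_refl X (D : qcdiv X) : qcd_eq D D.
Proof. by apply/qcd_eqP; exists 0%N. Qed.

Lemma qcd_eq_sym X (D E : qcdiv X) : qcd_eq D E -> qcd_eq E D.
Proof. by move=> /qcd_eqP [N h]; apply/qcd_eqP; exists N. Qed.

Lemma qcd_eq_trans X (D E F : qcdiv X) : qcd_eq D E -> qcd_eq E F -> qcd_eq D F.
Proof.
move=> /qcd_eqP [N h] /qcd_eqP [M h']; apply/qcd_eqP.
(* The denominator of [E] joins the multiplier, since torsion may forbid cancelling it. *)
exists (N.+1 * M.+1 * E.2.+1).-1 => x; rewrite prednK //.
have -> : (N.+1 * M.+1 * E.2.+1 * F.2.+1 = N.+1 * E.2.+1 * (M.+1 * F.2.+1))%N by lia.
rewrite mulrnA h -mulrnA mulnC mulrnA h' -mulrnA; congr (_ *+ _); lia.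
Qed.

Lemma qcd_add1 X (D E : qcdiv X) x :
  cd_at (qcd_add D E).1 x = cd_at D.1 x *+ E.2.+1 + cd_at E.1 x *+ D.2.+1.
Proof. by rewrite cd_at_add !cd_at_muln. Qed.

Lemma qcd_add2 X (D E : qcdiv X) : (qcd_add D E).2.+1 = (D.2.+1 * E.2.+1)%N.
Proof. by rewrite prednK. Qed.

Lemma ldiv_eq_rat L X (D E : ldiv L X) :
  ldiv_eq D E -> qcd_eq (ldiv_rat D) (ldiv_rat E).
Proof.
case: L D E => //= D E /cd_eqP h; apply/qcd_eqP.
by exists 0%N => x /=; rewrite h.
Qed.

Lemma ldiv_add_rat L X (D E : ldiv L X) :
  qcd_eq (ldiv_rat (ldiv_add D E)) (qcd_add (ldiv_rat D) (ldiv_rat E)).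
Proof.
case: L D E => D E /=; last exact: qcd_eq_refl.
by apply/qcd_eqP; exists 0%N => x; rewrite /= !(cd_at_add, cd_at_muln).
Qed.

Lemma qcd_eq_add X (D E D' E' : qcdiv X) : qcd_eq D D' -> qcd_eq E E' ->
  qcd_eq (qcd_add D E) (qcd_add D' E').
Proof.
move=> /qcd_eqP [N h] /qcd_eqP [M h']; apply/qcd_eqP.
exists (N.+1 * M.+1).-1 => x; rewrite prednK // !qcd_add2 !qcd_add1.
rewrite !mulrnDl -!mulrnA; congr (_ + _).
  have -> : (E.2.+1 * (N.+1 * M.+1 * (D'.2.+1 * E'.2.+1)) =
    (N.+1 * D'.2.+1) * (M.+1 * E.2.+1 * E'.2.+1))%N by lia.
  rewrite mulrnA h -mulrnA; congr (_ *+ _); lia.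
have -> : (D.2.+1 * (N.+1 * M.+1 * (D'.2.+1 * E'.2.+1)) =
  (M.+1 * E'.2.+1) * (N.+1 * D.2.+1 * D'.2.+1))%N by lia.
rewrite mulrnA h' -mulrnA; congr (_ *+ _); lia.
Qed.

Lemma effective_with_support_rat L X (D : ldiv L X) S :
  effective_with_support D S -> exists E p q,
  [/\ cd_effective E, qcd_eq (ldiv_rat D) (cd_muln p.+1 E, q)
    & S = cd_support E].
Proof.
case: L D => D /= => [[eD ->]|[E [p [q [eE p0 h ->]]]]].
  exists D, 0%N, 0%N; split=> //; apply/qcd_eqP; exists 0%N => x /=.
  by rewrite cd_at_muln.
by exists E, p.-1, q; rewrite prednK.
Qed.

Lemma ldiv_is_pullback_rat L X Y (f : mor Y X) (D : ldiv L X) (E : ldiv L Y) :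
  ldiv_is_pullback f D E -> qcd_is_pullback f (ldiv_rat D) (ldiv_rat E).
Proof.
case: L D E => //= D E pDE; exists D, E, 0%N.
by split=> //; exact: qcd_eq_refl.
Qed.

(* A local equation of an effective divisor pulls back to a nonzerodivisor as
   soon as some power of it does. *)
Lemma qcd_pullback_ex X Y (f : mor Y X) (D : qcdiv X) (E : qcdiv Y) c n :
  qcd_is_pullback f D E -> qcd_eq D (c, n) -> cd_effective c ->
  exists2 g, cd_is_pullback f c g & qcd_eq E (g, n).
Proof.
move=> [C [C' [m [DC pC EC']]]] Dc ec.
have /qcd_eqP [N /= h] := qcd_eq_trans (qcd_eq_sym Dc) DC.
have pN y : pullback_at (cd_at c (f y) *+ (N.+1 * m.+1)) (cd_at C' y *+ (N.+1 * n.+1)).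
  rewrite h; apply: divgrp_pullbackMn; first exact: stalk_map_morphism.
  exact: cd_is_pullback_at.
have [|g pg] := cd_pullback_ex ec (f := f).
  (* The multiplier is positive, so the multiple of [c] is [c] plus an effective remainder. *)
  move=> y; have := pN y; rewrite mulSn addSn mulrS => pS.
  have ey := (cd_effectiveP _).1 ec (f y).
  exact (divgrp_pullback_summand (stalk_map_morphism f y) ey (effectiveMn _ ey) pS).
exists g => //; apply: (qcd_eq_trans EC'); apply/qcd_eqP; exists N => y /=.
apply: (divgrp_pullback_inj (stalk_map_morphism f y) (pN y)).
apply: divgrp_pullbackMn; first exact: stalk_map_morphism.
exact: cd_is_pullback_at.
Qed.

(** The difference is taken with denominators crossed. The factor [M.+1], uniform in [x], is there
    because on a general scheme a divisor with an effective multiple need not be effective. *)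
Definition qcd_le X (D D' : qcdiv X) := exists M, forall x,
  effective ((cd_at D'.1 x *+ D.2.+1 - cd_at D.1 x *+ D'.2.+1) *+ M.+1).

Lemma qcd_le_congr X (D D' E E' : qcdiv X) : qcd_eq D E -> qcd_eq D' E' ->
  qcd_le D D' -> qcd_le E E'.
Proof.
move=> /qcd_eqP [N h] /qcd_eqP [N' h'] [M le].
exists (N.+1 * N'.+1 * D.2.+1 * D'.2.+1 * M.+1).-1 => x; rewrite prednK //.
have := effectiveMn (N.+1 * N'.+1 * E.2.+1 * E'.2.+1) (le x).
congr effective; rewrite !mulrnBl -!mulrnA; congr (_ - _).
  have -> : (D.2.+1 * (M.+1 * (N.+1 * N'.+1 * E.2.+1 * E'.2.+1)) =
    (N'.+1 * E'.2.+1) * (D.2.+1 * M.+1 * N.+1 * E.2.+1))%N by lia.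
  rewrite mulrnA h' -mulrnA; congr (_ *+ _); lia.
have -> : (D'.2.+1 * (M.+1 * (N.+1 * N'.+1 * E.2.+1 * E'.2.+1)) =
  (N.+1 * E.2.+1) * (D'.2.+1 * M.+1 * N'.+1 * E'.2.+1))%N by lia.
rewrite mulrnA h -mulrnA; congr (_ *+ _); lia.
Qed.

Lemma ldiv_le_rat L X (D D' : ldiv L X) :
  ldiv_le D D' -> qcd_le (ldiv_rat D) (ldiv_rat D').
Proof.
move=> [S]; case: L D D' => D D' /=.
  move=> [/cd_effectiveP e _]; exists 0%N => x /=.
  by have := e x; rewrite cd_at_add cd_at_opp.
move=> [E [p [q [/cd_effectiveP eE p0 /qcd_eqP [N h] _]]]].
exists (N.+1 * q.+1).-1 => x; have := h x.
rewrite qcd_add1 qcd_add2 cd_at_opp cd_at_muln mulNrn prednK // => ->.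
by rewrite -mulrnA; exact: effectiveMn.
Qed.

(** Over [LambdaQ] the factor [M.+1] goes into the denominator; over [LambdaZ] it must be divided
    out, which is what the hypothesis is for. *)
Lemma ldiv_leI L X (D D' : ldiv L X) :
  (L = LambdaZ -> forall (E : cdiv X) n,
    cd_effective (cd_muln n.+1 E) -> cd_effective E) ->
  qcd_le (ldiv_rat D) (ldiv_rat D') -> ldiv_le D D'.
Proof.
case: L D D' => D D' norm [M le].
  have {}norm := norm erefl; exists (cd_support (cd_add D' (cd_opp D))); split=> //.
  apply: (norm _ M); apply/cd_effectiveP => x.
  by rewrite cd_at_muln cd_at_add cd_at_opp; exact: le.
set E := cd_add (cd_muln D.2.+1 D'.1) (cd_muln D'.2.+1 (cd_opp D.1)).
have EE x : cd_at E x = cd_at D'.1 x *+ D.2.+1 - cd_at D.1 x *+ D'.2.+1.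
  by rewrite /E !(cd_at_add, cd_at_muln, cd_at_opp) mulNrn.
have eE : cd_effective (cd_muln M.+1 E).
  by apply/cd_effectiveP => x; rewrite cd_at_muln EE.
exists (cd_support (cd_muln M.+1 E)), (cd_muln M.+1 E), 1%N.
exists (M.+1 * (D'.2.+1 * D.2.+1)).-1; split=> //.
apply/qcd_eqP; exists 0%N => x; rewrite qcd_add2 !cd_at_muln -!mulrnA prednK //.
congr (_ *+ _); rewrite [(qcd_opp D).2]/=; lia.
Qed.

Definition divisor_condition L Y X X' (f : mor Y X) (g : mor Y X') (D : ldiv L X)
    (D' : ldiv L X') :=
  exists E E', [/\ ldiv_is_pullback f D E, ldiv_is_pullback g D' E' & ldiv_le E' E].

(** Turns the last clause of [admissible] into an inequality free of the coefficient ring;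
    [divisor_conditionI] returns from it to either ring. *)
Lemma divisor_conditionE L Y X X' (f : mor Y X) (g : mor Y X') (D : ldiv L X)
    (D' : ldiv L X') c n c' n' :
  qcd_eq (ldiv_rat D) (c, n) -> qcd_eq (ldiv_rat D') (c', n') ->
  cd_effective c -> cd_effective c' -> divisor_condition f g D D' ->
  exists e e', [/\ cd_is_pullback f c e, cd_is_pullback g c' e'
    & qcd_le (e', n') (e, n)].
Proof.
move=> Dc Dc' ec ec' [E [E' [/ldiv_is_pullback_rat pE /ldiv_is_pullback_rat pE' le]]].
have [e pe Ee] := qcd_pullback_ex pE Dc ec.
have [e' pe' Ee'] := qcd_pullback_ex pE' Dc' ec'.
exists e, e'; split=> //; apply: (qcd_le_congr Ee' Ee); exact: ldiv_le_rat.
Qed.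

Lemma ldiv_pullback_ex L X Y (f : mor Y X) (D : ldiv L X) S c n e :
  effective_with_support D S -> qcd_eq (ldiv_rat D) (c, n) ->
  cd_is_pullback f c e ->
  exists2 E, ldiv_is_pullback f D E & qcd_eq (ldiv_rat E) (e, n).
Proof.
case: L D => D; last first.
  move=> _ Dc pe; exists (e, n); last exact: qcd_eq_refl.
  by exists c, e, n; split=> //; exact: qcd_eq_refl.
(* Here [D] is itself an effective integral divisor, so existence passes from [c] back to [D]. *)
move=> [eD _] Dc pe; have pQ : qcd_is_pullback f (c, n) (e, n).
  by exists c, e, n; split=> //; exact: qcd_eq_refl.
have [E pE eE] := qcd_pullback_ex pQ (qcd_eq_sym Dc) eD.
by exists E => //; exact: qcd_eq_sym.
Qed.

Lemma divisor_conditionI L Y X X' (f : mor Y X) (g : mor Y X') (D : ldiv L X)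
    (D' : ldiv L X') S S' c n c' n' e e' :
  (L = LambdaZ -> forall (E : cdiv Y) n,
    cd_effective (cd_muln n.+1 E) -> cd_effective E) ->
  effective_with_support D S -> effective_with_support D' S' ->
  qcd_eq (ldiv_rat D) (c, n) -> qcd_eq (ldiv_rat D') (c', n') ->
  cd_is_pullback f c e -> cd_is_pullback g c' e' -> qcd_le (e', n') (e, n) ->
  divisor_condition f g D D'.
Proof.
move=> norm eD eD' Dc Dc' pe pe' le.
have [E pE Ee] := ldiv_pullback_ex eD Dc pe.
have [E' pE' Ee'] := ldiv_pullback_ex eD' Dc' pe'.
exists E, E'; split=> //; apply: ldiv_leI norm _.
by apply: qcd_le_congr le; exact: qcd_eq_sym.
Qed.

End RationalDivisors.

(** * Moduli and cube invariance *)

Section Presentation.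

Section Quotient.
Variables (V W : zmodType) (S : set V).

Lemma quotient_class_eq (x y : V) :
  quotient_class S x = quotient_class S y <-> x - y \in subgroup_gen S.
Proof.
by rewrite Quotient.idealrBE; split=> /eqP.
Qed.

Lemma quotient_classB : zmod_morphism (quotient_class S).
Proof. exact: raddfB. Qed.

Lemma quotient_classP (xi : quotient_by S) : exists x, xi = quotient_class S x.
Proof. by exists (repr xi); rewrite /quotient_class reprK. Qed.

Lemma quotient_lift (f : V -> W) : zmod_morphism f ->
  (forall s, S s -> f s = 0) ->
  exists2 g : quotient_by S -> W, zmod_morphism g
    & forall x, g (quotient_class S x) = f x.
Proof.
move=> fB fS; have f0 : f 0 = 0 by rewrite -(subrr 0) fB subrr.
pose g (xi : quotient_by S) := f (repr xi).
have gE x : g (quotient_class S x) = f x.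
  have : quotient_class S (repr (quotient_class S x)) = quotient_class S x.
    by rewrite /quotient_class reprK.
  move=> /quotient_class_eq/asboolP h; apply/subr0_eq; rewrite -fB.
  by apply: (h [set z | f z = 0]) => //= a b; rewrite fB => -> ->; rewrite subrr.
exists g => // xi eta.
have [x ->] := quotient_classP xi; have [y ->] := quotient_classP eta.
by rewrite -quotient_classB !gE fB.
Qed.
End Quotient.

Lemma free_ab_lift (T : Type) (W : zmodType) (psi : T -> W) :
  exists2 g : free_ab T -> W, zmod_morphism g & forall t, g (free_basis t) = psi t.
Proof.
(* [{classic T}] gives the bare type [T] the choice structure required by sums over finite sets. *)
pose supp (z : free_ab T) : set {classic T} := [set t | z t != 0].
have finS z : finite_set (supp z) by have /asboolP := fcoefP z.
pose g (z : free_ab T) : W :=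
  \big[+%R/0]_(t \in supp z) (psi t *~ z (t : {classic T})).
have gE z (A : set {classic T}) : finite_set A -> supp z `<=` A ->
    g z = \big[+%R/0]_(t \in A) (psi t *~ z t).
  move=> fA sA; apply: fsbig_widen => // t [_ /negP].
  by rewrite negbK => /eqP zt /=; rewrite zt mulr0z.
exists g => [z w|t].
  have fA : finite_set (supp z `|` supp w) by rewrite finite_setU; split.
  have sub : supp (z - w) `<=` supp z `|` supp w.
    move=> t; change (z t - w t != 0 -> (supp z `|` supp w) t).
    have [->|? _] := eqVneq (z t) 0; last by left.
    by rewrite sub0r oppr_eq0; right.
  rewrite (gE _ _ fA sub) (gE z _ fA (@subsetUl _ _ _)) (gE w _ fA (@subsetUr _ _ _)).
  apply/eqP; rewrite eq_sym subr_eq -fsbig_split //; apply/eqP.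
  apply: eq_fsbigr => t _.
  change (psi t *~ z t = psi t *~ (z t - w t) + psi t *~ w t).
  by rewrite -mulrzDr subrK.
rewrite (gE _ [set t]) ?fsbig_set1 //=.
  by rewrite asboolT //= mulr1z.
by move=> t'; rewrite /supp /=; case: asboolP.
Qed.

End Presentation.

(** * Moduli as vanishing on the cube relations *)

Section Modulus.
Variables (k : fieldType) (F : presheaf_with_transfers k).

(* the vanishing of a : Z_tr(S) -> F on the relations defining h_0(Y) *)
Definition cube_invariant L (S : smooth_scheme k) (a : F S) (Y : modulus_pair L S) :=
  forall S1 (T : modulus_pair L S1) n (C : cube k) S' (T' : modulus_pair L S')
    (p : mor (mp_sch T') (mp_sch (mp_mul n T)))
    (q : mor (mp_sch T') (mp_sch (box L C)))
    (i0 i1 : mcor (mp_mul n T) T') (x : mcor T' Y) (y0 y1 : mcor (mp_mul n T) Y),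
  is_tensor p q -> is_cube_section p q 0 i0 -> is_cube_section p q 1 i1 ->
  is_comp i0 x y0 -> is_comp i1 x y1 ->
  pst_map y0 a = pst_map y1 a.

Lemma modulus_cube_invariant L S (a : F S) (Y : modulus_pair L S) :
  is_modulus a Y -> cube_invariant a Y.
Proof.
move=> [phi [phiB _ phiP]] S1 T n C S' T' p q i0 i1 x y0 y1 tens s0 s1 c0 c1.
have proj (y : mcor (mp_mul n T) Y) : pst_map y a =
    phi S1 T (kan_class (G := h0_cube (yoneda Y)) (quotient_class _ y)).
  by rewrite (phiP S1 T y) //; exists n, y.
rewrite !proj; congr (phi _ _ (kan_class _)).
apply/quotient_class_eq/asboolP => H _ _; apply.
by exists C, S', T', p, q, i0, i1, x, y0, y1.
Qed.

(** Evaluation at [a] descends to the cube quotient at each stage [n], then to the colimit, whose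
    transition maps are identity correspondences. Naturality follows because both actions compose
    the same cycles. *)
Lemma cube_invariant_modulus L S (a : F S) (Y : modulus_pair L S) :
  cube_invariant a Y -> is_modulus a Y.
Proof.
move=> inv; pose G := yoneda Y.
have lift1 S1 (T : modulus_pair L S1) n :
    exists2 g : h0_cube G S1 (mp_mul n T) -> F S1, zmod_morphism g
      & forall y : mcor (mp_mul n T) Y, g (quotient_class _ y) = pst_map y a.
  apply: (quotient_lift (V := mcor (mp_mul n T) Y)
    (f := fun y : mcor (mp_mul n T) Y => pst_map y a)).
    by move=> y z; exact: pst_biadditive.
  move=> _ [C [S' [T' [p [q [i0 [i1 [x [y0 [y1 [tens [s0 s1] c0 c1 ->]]]]]]]]]]].
  have -> := pst_biadditive a y0 y1.
  by rewrite (inv _ _ _ _ _ _ _ _ _ _ _ _ _ tens s0 s1 c0 c1) subrr.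
have lift2 S1 (T : modulus_pair L S1) :
    exists2 g : h0 Y T -> F S1, zmod_morphism g
      & forall n (y : mcor (mp_mul n T) Y),
        g (kan_class (G := h0_cube G) (quotient_class _ y)) = pst_map y a.
  pose g1 n := projT1 (cid2 (lift1 S1 T n)).
  have g1B n : zmod_morphism (g1 n) by rewrite /g1; case: cid2.
  have g1E n (y : mcor (mp_mul n T) Y) : g1 n (quotient_class _ y) = pst_map y a.
    by rewrite /g1; case: cid2.
  have [g2 g2B g2E] := free_ab_lift
    (fun t : kan_generators (h0_cube G) T => g1 (projT1 t) (projT2 t)).
  have g2k n (y : h0_cube G S1 (mp_mul n T)) : g2 (kan_basis y) = g1 n y.
    exact: g2E.
  have [r|g3 g3B g3E] := @quotient_lift _ _ (@kan_relations _ _ (h0_cube G) _ T) g2 g2B.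
    move=> [[n [x [y ->]]]|[m [n [x [y [delta [mn gr [x' [y' [<- <- c]]] ->]]]]]]].
      rewrite !g2B !g2k; have := g1B n (x + y) y; rewrite addrK => ->.
      by rewrite subKr subrr.
    rewrite g2B !g2k !g1E (pst_comp a c) (pst_id _ gr) subrr //.
  by exists g3 => // n y; rewrite /kan_class g3E g2k g1E.
pose phi S1 (T : modulus_pair L S1) := projT1 (cid2 (lift2 S1 T)).
have phiE S1 (T : modulus_pair L S1) n (y : mcor (mp_mul n T) Y) :
    phi S1 T (kan_class (G := h0_cube G) (quotient_class _ y)) = pst_map y a.
  by rewrite /phi; case: cid2.
exists phi; split.
- by move=> S1 T; rewrite /phi; case: cid2.
- move=> S1 S2 T1 T2 b _ _ [m [n [_ [_ [delta [-> -> <- [x [y [<- <- c]]]]]]]]].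
  by rewrite !phiE (pst_comp a c).
- by move=> S1 T _ _ [n [x [<- ->]]]; rewrite phiE.
Qed.

End Modulus.

(** * Comparison of divisors *)

Section EffectiveCone.
Variable A : comPzRingType.
Implicit Types g h : divgrp A.

Lemma effectiveD_eq0 g h : effective g -> effective h -> g + h = 0 -> g = 0.
Proof.
move=> eg eh /eqP; rewrite addrC addr_eq0 => /eqP e.
by apply: effective_anti; rewrite -?e.
Qed.

Lemma effectiveMn_eq0 g n : effective g -> g *+ n.+1 = 0 -> g = 0.
Proof. by move=> eg; rewrite mulrS; exact: effectiveD_eq0 (effectiveMn n eg). Qed.

End EffectiveCone.

Section Combinations.
Variable k : fieldType.
Implicit Types X Y : kscheme k.

Lemma cd_effective_add X (D E : cdiv X) :
  cd_effective D -> cd_effective E -> cd_effective (cd_add D E).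
Proof.
move=> /cd_effectiveP eD /cd_effectiveP eE; apply/cd_effectiveP => x.
by rewrite cd_at_add; exact: effectiveD.
Qed.

(** An effective class with a vanishing positive multiple is zero, despite possible torsion; so the
    support depends only on the class with rational coefficients. *)
Lemma cd_support_congr X (D E : cdiv X) m n : cd_effective D -> cd_effective E ->
  (forall x, cd_at D x *+ m.+1 = cd_at E x *+ n.+1) -> cd_support D = cd_support E.
Proof.
move=> /cd_effectiveP eD /cd_effectiveP eE h; apply/seteqP.
split=> x /cd_supportP nz; apply/cd_supportP => z; apply: nz.
  by apply: (effectiveMn_eq0 (n := m)) => //; rewrite h z mul0rn.
by apply: (effectiveMn_eq0 (n := n)) => //; rewrite -h z mul0rn.
Qed.

Lemma cd_support_add_muln X (D E : cdiv X) n : cd_effective D -> cd_effective E ->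
  cd_support (cd_add D (cd_muln n.+1 E)) = cd_support (cd_add D E).
Proof.
move=> /cd_effectiveP eD /cd_effectiveP eE; apply/seteqP.
split=> x /cd_supportP nz; apply/cd_supportP => z; apply: nz; move: z;
  rewrite !cd_at_add !cd_at_muln => z.
  have D0 := effectiveD_eq0 (eD x) (eE x) z.
  by move: z; rewrite D0 !add0r => ->; rewrite mul0rn.
have D0 := effectiveD_eq0 (eD x) (effectiveMn n.+1 (eE x)) z.
by move: z; rewrite D0 !add0r; exact: effectiveMn_eq0.
Qed.

Lemma cd_is_pullback_add X Y (f : mor Y X) D E D' E' :
  cd_effective D -> cd_effective E ->
  cd_is_pullback f D D' -> cd_is_pullback f E E' ->
  cd_is_pullback f (cd_add D E) (cd_add D' E').
Proof.
move=> eD eE pD pE; apply: cd_is_pullbackI; first exact: cd_effective_add.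
move=> y; rewrite !cd_at_add.
by apply: divgrp_pullbackD; [exact: stalk_map_morphism | exact: cd_is_pullback_at..].
Qed.

(** The divisor of a tensor product is known to pull back only as a whole; its two parts must be
    separated before their coefficients can be changed. *)
Lemma cd_is_pullback_split X Y (f : mor Y X) D E n G :
  cd_effective D -> cd_effective E ->
  cd_is_pullback f (cd_add D (cd_muln n.+1 E)) G ->
  exists D' E', [/\ cd_is_pullback f D D', cd_is_pullback f E E'
    & forall y, cd_at G y = cd_at D' y + cd_at E' y *+ n.+1].
Proof.
move=> eD eE pG.
have pGy y : pullback_at (cd_at D (f y) + cd_at E (f y) *+ n.+1) (cd_at G y).
  by rewrite -cd_at_muln -cd_at_add; exact: cd_is_pullback_at.
have eDy y := (cd_effectiveP D).1 eD (f y).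
have eEy y := (cd_effectiveP E).1 eE (f y).
have [|D' pD] := cd_pullback_ex eD (f := f).
  move=> y; exact (divgrp_pullback_summand (stalk_map_morphism f y) (eDy y)
    (effectiveMn n.+1 (eEy y)) (pGy y)).
have [|E' pE] := cd_pullback_ex eE (f := f).
  move=> y; have := pGy y; rewrite addrC mulrS -addrA => h.
  exact (divgrp_pullback_summand (stalk_map_morphism f y) (eEy y)
    (effectiveD (effectiveMn n (eEy y)) (eDy y)) h).
exists D', E'; split=> // y.
apply: (divgrp_pullback_inj (stalk_map_morphism f y) (pGy y)).
apply: divgrp_pullbackD; first exact: stalk_map_morphism.
  exact: cd_is_pullback_at.
by apply: divgrp_pullbackMn; [exact: stalk_map_morphism | exact: cd_is_pullback_at].
Qed.

Lemma qcd_leI X (D E : qcdiv X) :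
  (forall x, effective (cd_at E.1 x *+ D.2.+1 - cd_at D.1 x *+ E.2.+1)) ->
  qcd_le D E.
Proof. by move=> h; exists 0%N. Qed.

Lemma qcd_le_trans X (D E G : qcdiv X) : qcd_le D E -> qcd_le E G -> qcd_le D G.
Proof.
move=> [M h] [M' h']; exists (M.+1 * M'.+1 * E.2.+1).-1 => x; rewrite prednK //.
have := effectiveD (effectiveMn (M.+1 * D.2.+1) (h' x))
  (effectiveMn (M'.+1 * G.2.+1) (h x)).
congr effective; rewrite !mulrnBl -!mulrnA.
have -> : (G.2.+1 * (M'.+1 * (M.+1 * D.2.+1)) = D.2.+1 * (M.+1 * (M'.+1 * G.2.+1)))%N
  by lia.
rewrite addrA subrK; congr (_ *+ _ - _ *+ _); lia.
Qed.

Lemma qcd_le_cancel X (D E : cdiv X) n : qcd_le (D, n) (E, n) -> qcd_le (D, 0%N) (E, 0%N).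
Proof.
move=> [M h]; exists (n.+1 * M.+1).-1 => x; rewrite prednK //.
by have := h x; rewrite -mulrnBl -mulrnA.
Qed.

Lemma qcd_le_integral X (D : cdiv X) n : cd_effective D -> qcd_le (D, n) (D, 0%N).
Proof.
move=> /cd_effectiveP eD; apply: qcd_leI => x.
by rewrite /= mulr1n mulrSr addrK; exact: effectiveMn.
Qed.

End Combinations.

(** * Change of coefficients *)

Section ModulusPairs.
Variable k : fieldType.
Implicit Types (S : smooth_scheme k) (L : coefficient_ring).

Definition mp_change L L' S (T : modulus_pair L S) (D : ldiv L' (mp_sch T))
    (h : effective_with_support D (~` range (mp_j T))) : modulus_pair L' S :=
  ModulusPair (mp_proper T) (mp_open T) h.

Lemma integral_divisor L S (T : modulus_pair L S) : exists c n,
  [/\ cd_effective c, qcd_eq (ldiv_rat (mp_div T)) (c, n)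
    & forall L', effective_with_support (ldiv_of_cdiv L' c) (~` range (mp_j T))].
Proof.
have [E [p [q [eE DE sE]]]] := effective_with_support_rat (mp_support T).
have ec := cd_effective_muln p.+1 eE; exists (cd_muln p.+1 E), q.
split=> // L'; rewrite sE -(cd_support_muln p eE).
exact: effective_with_support_of_cdiv.
Qed.

Lemma ldiv_of_cdiv_rat L (X : kscheme k) (c : cdiv X) :
  qcd_eq (ldiv_rat (ldiv_of_cdiv L c)) (c, 0%N).
Proof. by case: L; exact: qcd_eq_refl. Qed.

Lemma ldiv_mul1_rat L (X : kscheme k) (c : cdiv X) :
  qcd_eq (ldiv_rat (ldiv_muln 1 (ldiv_of_cdiv L c))) (c, 0%N).
Proof.
by case: L; apply/qcd_eqP; exists 0%N => x; rewrite /= cd_at_muln mulr1n.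
Qed.

(* The scheme-theoretic data of an admissible correspondence does not involve
   the moduli, so that only the inequality of divisors has to be compared; it
   lives on a normal scheme, where effectivity is insensitive to multiples. *)
Lemma admissible_change L L' S S' (T : modulus_pair L S) (T' : modulus_pair L S')
    (D : ldiv L' (mp_sch T)) (D' : ldiv L' (mp_sch T'))
    (h : effective_with_support D (~` range (mp_j T)))
    (h' : effective_with_support D' (~` range (mp_j T'))) v :
  (forall N (f : mor N (mp_sch T)) (g : mor N (mp_sch T')),
    (forall (E : cdiv N) n, cd_effective (cd_muln n.+1 E) -> cd_effective E) ->
    divisor_condition f g (mp_div T) (mp_div T') -> divisor_condition f g D D') ->
  admissible T T' v -> admissible (mp_change h) (mp_change h') v.
Proof.
move=> H [jj [V [i [N [nu [e1 e2 e3 norm dc]]]]]]; exists jj, V, i, N, nu.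
split; [exact: e1|exact: e2|exact: e3|exact: norm|].
apply: H dc => E n; exact: (normal_effective norm).
Qed.

Lemma mcor_transfer L L' S S' (T : modulus_pair L S) (T' : modulus_pair L S')
    (T1 : modulus_pair L' S) (T1' : modulus_pair L' S') (delta : mcor T T') :
  (forall v, admissible T T' v -> admissible T1 T1' v) ->
  exists d : mcor T1 T1', mcycle d = delta.
Proof.
move=> H; have ok : mcycle delta \in is_mcor T1 T1'.
  by apply/asboolP => v av; apply: H; have /asboolP h := mcycleP delta; exact: h.
by exists (MCor ok).
Qed.

(** [u / (n+1) + v] is brought to the common denominator [n+1]. Changing the positive coefficients
    to [u + v] preserves the support, so the new divisor gives a modulus pair with the same
    interior. *)
Lemma tensor_divisor L S S' (C : cube k) (W : modulus_pair L S)
    (T : modulus_pair L S') (p : mor (mp_sch T) (mp_sch W))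
    (q : mor (mp_sch T) (mp_sch (box L C))) c n :
  is_tensor p q -> cd_effective c -> qcd_eq (ldiv_rat (mp_div W)) (c, n) ->
  exists u v,
  [/\ cd_is_pullback p c u /\ cd_is_pullback q (cb_inf C) v,
      cd_effective u /\ cd_effective v,
      qcd_eq (ldiv_rat (mp_div T)) (cd_add u (cd_muln n.+1 v), n)
    & forall L', effective_with_support (ldiv_of_cdiv L' (cd_add u v))
        (~` range (mp_j T))].
Proof.
move=> [_ [E [E' [/ldiv_is_pullback_rat pE /ldiv_is_pullback_rat pE' eT]]]] ec Wc.
have eI := @cb_inf_eff _ C.
have [u pu Eu] := qcd_pullback_ex pE Wc ec.
have [v pv Ev] := qcd_pullback_ex pE' (ldiv_of_cdiv_rat L _) eI.
have eu := cd_pullback_effective ec pu; have ev := cd_pullback_effective eI pv.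
have Tuv : qcd_eq (ldiv_rat (mp_div T)) (cd_add u (cd_muln n.+1 v), n).
  apply: qcd_eq_trans (ldiv_eq_rat eT) _.
  apply: qcd_eq_trans (ldiv_add_rat _ _) _.
  apply: qcd_eq_trans (qcd_eq_add Eu Ev) _.
  apply/qcd_eqP; exists 0%N => x.
  by rewrite qcd_add1 qcd_add2 cd_at_add cd_at_muln mulr1n muln1.
exists u, v; split=> // L'.
(* The boundary of [T] is the support of its own integral divisor [c'], which is then compared with
   [u + (n+1) v]. *)
have [c' [n' [ec' Tc' /(_ LambdaZ) [_ sT]]]] := integral_divisor T.
have euv : cd_effective (cd_add u (cd_muln n.+1 v)).
  by apply: cd_effective_add => //; exact: cd_effective_muln.
have -> : ~` range (mp_j T) = cd_support (cd_add u v).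
  rewrite sT -(cd_support_add_muln n eu ev).
  have /qcd_eqP [N h] := qcd_eq_trans (qcd_eq_sym Tc') Tuv.
  by apply: cd_support_congr ec' euv h.
exact/effective_with_support_of_cdiv/cd_effective_add.
Qed.

Lemma integral_tensor L S S' (C : cube k) (T : modulus_pair L S)
    (T' : modulus_pair L S') (p : mor (mp_sch T') (mp_sch T))
    (q : mor (mp_sch T') (mp_sch (box L C))) c u v :
  is_product p q -> cd_is_pullback p c u -> cd_is_pullback q (cb_inf C) v ->
  mp_div T = ldiv_muln 1 (ldiv_of_cdiv L c) ->
  mp_div T' = ldiv_of_cdiv L (cd_add u v) -> is_tensor p q.
Proof.
move=> prod pu pv eT eT'; split=> //; rewrite eT eT' {eT eT'}.
(* First powers are convertible to their base, so the equations of [c] serve again. *)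
have pu1 : cd_is_pullback p (cd_muln 1 c) u.
  by move=> y; have [V [a [b [Vy la lb]]]] := pu y; exists V, a, b.
exists (ldiv_of_cdiv L u), (ldiv_of_cdiv L v); rewrite [mp_div _]/=.
destruct L; split=> //=.
- by apply/cd_eqP.
- by exists (cd_muln 1 c), u, 0%N; split=> //; exact: qcd_eq_refl.
- by exists (cb_inf C), v, 0%N; split=> //; exact: qcd_eq_refl.
- apply/qcd_eqP; exists 0%N => x.
  by rewrite qcd_add1 qcd_add2 cd_at_add !mulr1n.
Qed.

End ModulusPairs.

(** * Inequalities for the three kinds of arrows in a cube relation *)

Section DivisorConditions.
Variables (k : fieldType) (L L' : coefficient_ring).
Variables (N X X' : kscheme k) (f : mor N X) (g : mor N X').
Hypothesis normN : forall (E : cdiv N) n,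
  cd_effective (cd_muln n.+1 E) -> cd_effective E.

(** Both sides have denominator [n+1]. Cancelling it gives [c >= u + (n+1) v] after pullback, and
    the surplus [n v] is dropped. *)
Lemma section_condition (D : ldiv L X) (D' : ldiv L X') S S' n c u v :
  qcd_eq (ldiv_rat D) (c, n) ->
  qcd_eq (ldiv_rat D') (cd_add u (cd_muln n.+1 v), n) ->
  cd_effective c -> cd_effective u -> cd_effective v ->
  effective_with_support (ldiv_muln 1 (ldiv_of_cdiv L' c)) S ->
  effective_with_support (ldiv_of_cdiv L' (cd_add u v)) S' ->
  divisor_condition f g D D' ->
  divisor_condition f g (ldiv_muln 1 (ldiv_of_cdiv L' c))
    (ldiv_of_cdiv L' (cd_add u v)).
Proof.
move=> Dc Duv ec eu ev s s' dc.
have euv := cd_effective_add eu (cd_effective_muln n.+1 ev).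
have [e [e' [pe pe' le]]] := divisor_conditionE Dc Duv ec euv dc.
have [u' [v' [pu pv e'E]]] := cd_is_pullback_split eu ev pe'.
have [/cd_effectiveP eu' /cd_effectiveP ev'] :=
  conj (cd_pullback_effective eu pu) (cd_pullback_effective ev pv).
apply: (divisor_conditionI (fun=> normN) s s' (ldiv_mul1_rat L' c)
  (ldiv_of_cdiv_rat L' _) pe (cd_is_pullback_add eu ev pu pv)).
apply: qcd_le_trans (qcd_le_cancel le); apply: qcd_leI => y /=.
rewrite !mulr1n e'E cd_at_add opprD addrACA subrr add0r mulrSr addrK.
exact: effectiveMn.
Qed.

(** After pullback, [u + v >= u / (n+1) + v >= c >= c / (r+1)], the middle inequality being the
    given one. *)
Lemma tensor_condition (D : ldiv L X) (D' : ldiv L' X') S S' n u v c r :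
  qcd_eq (ldiv_rat D) (cd_add u (cd_muln n.+1 v), n) ->
  qcd_eq (ldiv_rat D') (c, r) ->
  cd_effective u -> cd_effective v -> cd_effective c ->
  effective_with_support (ldiv_of_cdiv L' (cd_add u v)) S ->
  effective_with_support D' S' ->
  divisor_condition f g D (ldiv_of_cdiv L c) ->
  divisor_condition f g (ldiv_of_cdiv L' (cd_add u v)) D'.
Proof.
move=> Duv D'c eu ev ec s s' dc.
have euv := cd_effective_add eu (cd_effective_muln n.+1 ev).
have [e [e' [pe pe' le]]] := divisor_conditionE Duv (ldiv_of_cdiv_rat L c) euv ec dc.
have [u' [v' [pu pv eE]]] := cd_is_pullback_split eu ev pe.
have [/cd_effectiveP eu' /cd_effectiveP ev'] :=
  conj (cd_pullback_effective eu pu) (cd_pullback_effective ev pv).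
apply: (divisor_conditionI (fun=> normN) s s' (ldiv_of_cdiv_rat L' _) D'c
  (cd_is_pullback_add eu ev pu pv) pe').
apply: qcd_le_trans (qcd_le_integral r (cd_pullback_effective ec pe')) _.
apply: qcd_le_trans le _; apply: qcd_leI => y /=.
rewrite mulr1n eE cd_at_add mulrnDl [cd_at u' y *+ _]mulrSr opprD addrACA subrr.
by rewrite addr0 addrK; exact: effectiveMn.
Qed.

(** After pullback, [c >= c / (n+1) >= c' >= c' / (r+1)], the middle inequality being the given
    one. *)
Lemma base_condition (D : ldiv L X) (D' : ldiv L' X') S S' n c c' r :
  qcd_eq (ldiv_rat D) (c, n) -> qcd_eq (ldiv_rat D') (c', r) ->
  cd_effective c -> cd_effective c' ->
  effective_with_support (ldiv_muln 1 (ldiv_of_cdiv L' c)) S ->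
  effective_with_support D' S' ->
  divisor_condition f g D (ldiv_of_cdiv L c') ->
  divisor_condition f g (ldiv_muln 1 (ldiv_of_cdiv L' c)) D'.
Proof.
move=> Dc D'c ec ec' s s' dc.
have [e [e' [pe pe' le]]] := divisor_conditionE Dc (ldiv_of_cdiv_rat L c') ec ec' dc.
apply: (divisor_conditionI (fun=> normN) s s' (ldiv_mul1_rat L' c) D'c pe pe').
apply: qcd_le_trans (qcd_le_integral r (cd_pullback_effective ec' pe')) _.
exact: qcd_le_trans le (qcd_le_integral n (cd_pullback_effective ec pe)).
Qed.

End DivisorConditions.

(** One argument serves both inclusions: the new modulus is the integral divisor [cY], and each cube
    relation over [L'] with target [cY] becomes one over [L] with target [Y]. *)
Lemma reciprocity_change (k : fieldType) (F : presheaf_with_transfers k)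
    (L L' : coefficient_ring) : reciprocity F L -> reciprocity F L'.
Proof.
move=> rec S a; have [Y /modulus_cube_invariant inv] := rec S a.
have [cY [r [ecY DY /(_ L') sY]]] := integral_divisor Y.
exists (mp_change sY); apply: cube_invariant_modulus.
move=> S1 T n C S' T' p q i0 i1 x y0 y1.
(* The stage [n] is forgotten: [W] is an arbitrary pair, and its replacement enters at stage 0,
   whence [mp_mul 0] in [W1]. *)
move: (mp_mul n T) p i0 i1 y0 y1 => W p i0 i1 y0 y1 tens sec0 sec1 comp0 comp1.
have [c [m [ec DW /(_ L) sW]]] := integral_divisor W.
have [u [v [[pu pv] [eu ev] DT /(_ L) sT]]] := tensor_divisor tens ec DW.
pose W1 := mp_mul 0 (mp_change sW); pose T1 := mp_change sT.
have sW1 := mp_support W1.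
have tr_i (d : mcor W T') : exists d1 : mcor W1 T1, mcycle d1 = d.
  apply: mcor_transfer => w; apply: admissible_change => N f g normN.
  exact (section_condition normN DW DT ec eu ev sW1 sT).
have tr_x (d : mcor T' (mp_change sY)) : exists d1 : mcor T1 Y, mcycle d1 = d.
  apply: mcor_transfer => w.
  apply: (@admissible_change _ _ L _ _ T' (mp_change sY) _ (mp_div Y)
    sT (mp_support Y)) => N f g normN.
  exact (tensor_condition normN DT DY eu ev ecY sT (mp_support Y)).
have tr_y (d : mcor W (mp_change sY)) : exists d1 : mcor W1 Y, mcycle d1 = d.
  apply: mcor_transfer => w.
  apply: (@admissible_change _ _ L _ _ W (mp_change sY) _ (mp_div Y)
    sW1 (mp_support Y)) => N f g normN.
  exact (base_condition normN DW DY ec ecY sW1 (mp_support Y)).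
have [j0 j0E] := tr_i i0; have [j1 j1E] := tr_i i1.
have [x1 x1E] := tr_x x; have [z0 z0E] := tr_y y0; have [z1 z1E] := tr_y y1.
(* Graphs and compositions involve only the underlying cycles, which have not changed. *)
rewrite -z0E -z1E; apply: (inv _ (mp_change sW) 0%N C S' T1 p q j0 j1 x1).
- exact: (@integral_tensor _ _ _ _ _ W1 T1 p q c u v tens.1).
- by move: sec0 => [h [? ? ?]]; exists h; rewrite j0E.
- by move: sec1 => [h [? ? ?]]; exists h; rewrite j1E.
- by rewrite j0E x1E z0E.
- by rewrite j1E x1E z1E.
Qed.

Theorem lemma3p20 (k : fieldType) (F : presheaf_with_transfers k) :
  reciprocity F LambdaZ <-> reciprocity F LambdaQ.
Proof. by split; exact: reciprocity_change. Qed.
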